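(* For each $0<l<L$, the global minimizers of $\mathcal{W}$ in $\mathcal{A}_{l,L}$ are $\hat\gamma_0^{\pm}$ (that is, $\gamma\in\mathcal{A}_{l,L}$ is a global minimizer of $\mathcal{W}$ in $\mathcal{A}_{l,L}$ if and only if its arc length reparameterization is $\hat\gamma_0^{+}$ or $\hat\gamma_0^{-}$). Consequently: (i) uniqueness of global minimizers holds up to reflection (across the $x$-axis, and up to reparameterization); (ii) a global minimizer has no loop, and its only inflection points are its endpoints.
   Context: For given $0<l<L$, $\mathcal{A}_{l,L}$ is the set of $\gamma\in C^\infty([0,1];\mathbb{R}^2)$ with $\gamma(0)=(0,0)$, $\gamma(1)=(l,0)$, $\gamma'(t)\neq0$ for all $t\in[0,1]$, and $\mathcal{L}(\gamma)=L$, where $\mathcal{L}$ denotes length. The elastic energy is $\mathcal{W}(\gamma)=\int_\gamma\kappa^2\,ds$, where $s$ is arc length and $\kappa$ the (signed) curvature. Complete elliptic integrals with modulus $p\in[0,1)$: $\mathrm{K}(p)=\int_0^1\frac{dz}{\sqrt{1-z^2}\sqrt{1-p^2z^2}}$ and $\mathrm{E}(p)=\int_0^1\frac{\sqrt{1-p^2z^2}}{\sqrt{1-z^2}}\,dz$. The Jacobi elliptic function is $\mathrm{cn}(x,p)=\cos\phi$, where $\phi=\mathrm{am}(x,p)$ is the inverse function of $x(\phi)=\int_0^\phi\frac{d\theta}{\sqrt{1-p^2\sin^2\theta}}$. Let $\hat p\in(0,1)$ be the unique solution of $2\,\mathrm{E}(p)/\mathrm{K}(p)-1=l/L$. Then $\hat\gamma_0^{\pm}(s)=(\hat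 X_0(s),\pm\hat Y_0(s))$ for $s\in[0,L]$ (arc length parameter), with $$\hat X_0(s)=2\hat p^2\int_0^s \mathrm{cn}\Big(\tfrac{2\mathrm{K}(\hat p)}{L}t+\mathrm{K}(\hat p),\hat p\Big)^2dt+(1-2\hat p^2)s,\qquad \hat Y_0(s)=-\frac{\hat p L}{\mathrm{K}(\hat p)}\,\mathrm{cn}\Big(\tfrac{2\mathrm{K}(\hat p)}{L}s+\mathrm{K}(\hat p),\hat p\Big).$$ A curve has a loop if it has a self-intersection, i.e. takes the same value at two distinct parameters. An inflection point is a point where the curvature changes sign; at an endpoint of the curve this is understood as vanishing of the curvature there. *)

(* Defs.v *)
From Stdlib Require Import Reals.
From Coquelicot Require Import Coquelicot.
Open Scope R_scope.

(** Functions and curves on [0,1] are represented by total functions on R.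
    Every notion below that concerns them depends only on their values on
    [0,1]; in particular derivatives are taken relative to [0,1], hence are
    one-sided at 0 and 1. As in Coquelicot, [iota P] is the unique element
    satisfying [P] (with an unspecified value if there is no unique one). *)

Definition I01 (t : R) : Prop := 0 <= t <= 1.

Definition is_derive01 (f : R -> R) (t d : R) : Prop :=
  filterlim (fun u => (f u - f t) / (u - t)) (within I01 (locally' t)) (locally d).

Definition Derive01 (f : R -> R) (t : R) : R := iota (fun d : R => is_derive01 f t d).

Fixpoint Derive01_n (f : R -> R) (n : nat) : R -> R :=
  match n with
  | O => f
  | S k => Derive01 (Derive01_n f k)
  end.

Definition smooth01 (f : R -> R) : Prop :=
  forall (n : nat) (t : R), I01 t -> exists d : R, is_derive01 (Derive01_n f n) t d.

Definition curve : Type := R -> R * R.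

Definition cx (g : curve) (t : R) : R := fst (g t).
Definition cy (g : curve) (t : R) : R := snd (g t).

Definition velocity (g : curve) (t : R) : R * R :=
  (Derive01 (cx g) t, Derive01 (cy g) t).

Definition acceleration (g : curve) (t : R) : R * R :=
  (Derive01_n (cx g) 2 t, Derive01_n (cy g) 2 t).

Definition speed (g : curve) (t : R) : R :=
  sqrt (fst (velocity g t) ^ 2 + snd (velocity g t) ^ 2).

Definition arclength (g : curve) (t : R) : R := RInt (speed g) 0 t.

Definition curve_length (g : curve) : R := arclength g 1.

Definition curvature (g : curve) (t : R) : R :=
  (fst (velocity g t) * snd (acceleration g t)
   - snd (velocity g t) * fst (acceleration g t)) / speed g t ^ 3.

Definition elastic_energy (g : curve) : R :=
  RInt (fun t => curvature g t ^ 2 * speed g t) 0 1.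

Definition admissible (l L : R) (g : curve) : Prop :=
  smooth01 (cx g) /\ smooth01 (cy g) /\
  g 0 = (0, 0) /\ g 1 = (l, 0) /\
  (forall t, I01 t -> velocity g t <> (0, 0)) /\
  curve_length g = L.

Definition global_minimizer (l L : R) (g : curve) : Prop :=
  admissible l L g /\
  forall h, admissible l L h -> elastic_energy g <= elastic_energy h.

(** The curve [0,L] -> R^2 sending the arc length at [t] to [g t]. *)
Definition arclength_reparam (g : curve) : curve :=
  fun s => g (iota (fun t : R => I01 t /\ arclength g t = s)).

Definition equal_up_to_reparam (g h : curve) : Prop :=
  exists phi : R -> R,
    smooth01 phi /\ phi 0 = 0 /\ phi 1 = 1 /\
    (forall t, I01 t -> 0 < Derive01 phi t) /\
    (forall t, I01 t -> h t = g (phi t)).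

Definition reflect_x (g : curve) : curve := fun t => (cx g t, - cy g t).

Definition has_loop (g : curve) : Prop :=
  exists t1 t2, I01 t1 /\ I01 t2 /\ t1 <> t2 /\ g t1 = g t2.

(** Arbitrarily close to [t], [k] takes strictly opposite signs on the two
    sides of [t]; this covers the case of a fixed sign on each side. *)
Definition changes_sign_at (k : R -> R) (t : R) : Prop :=
  forall eps : R, 0 < eps ->
    exists t1 t2, I01 t1 /\ I01 t2 /\
      t - eps < t1 < t /\ t < t2 < t + eps /\ k t1 * k t2 < 0.

Definition inflection_point (g : curve) (t : R) : Prop :=
  (0 < t < 1 /\ changes_sign_at (curvature g) t) \/
  ((t = 0 \/ t = 1) /\ curvature g t = 0).

(** The integrands are singular at 1, so these are improper integrals. *)
Definition ellK (p : R) : R :=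
  RInt_gen (fun z => 1 / (sqrt (1 - z ^ 2) * sqrt (1 - p ^ 2 * z ^ 2)))
    (at_point 0) (at_left 1).

Definition ellE (p : R) : R :=
  RInt_gen (fun z => sqrt (1 - p ^ 2 * z ^ 2) / sqrt (1 - z ^ 2))
    (at_point 0) (at_left 1).

Definition ellF (phi p : R) : R :=
  RInt (fun theta => 1 / sqrt (1 - p ^ 2 * sin theta ^ 2)) 0 phi.

Definition am (x p : R) : R := iota (fun phi : R => ellF phi p = x).

Definition cn (x p : R) : R := cos (am x p).

Definition hat_p (l L : R) : R :=
  iota (fun p : R => 0 < p < 1 /\ 2 * ellE p / ellK p - 1 = l / L).

Definition hat_X (l L s : R) : R :=
  let p := hat_p l L in
  2 * p ^ 2 * RInt (fun t => cn (2 * ellK p / L * t + ellK p) p ^ 2) 0 s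
  + (1 - 2 * p ^ 2) * s.

Definition hat_Y (l L s : R) : R :=
  let p := hat_p l L in
  - (p * L / ellK p) * cn (2 * ellK p / L * s + ellK p) p.

Definition hat_gamma_plus (l L : R) : curve := fun s => (hat_X l L s, hat_Y l L s).
Definition hat_gamma_minus (l L : R) : curve := fun s => (hat_X l L s, - hat_Y l L s).

Definition equal_on (L : R) (g h : curve) : Prop :=
  forall s, 0 <= s <= L -> g s = h s.

(* Main.v *)
Require Import Defs.
From Stdlib Require Import Reals.
From Coquelicot Require Import Coquelicot.
From Stdlib Require Import Lra FunctionalExtensionality.
Open Scope R_scope.

(** Why the theorem is true.

    Let [theta] be the tangent angle of an admissible curve as a function of arc
    length; the energy is the integral of [theta'^2], and the end conditions say
    that [cos theta] integrates to [l] and [sin theta] to [0] over [0,L]. The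
    difficulty is that the energy is not convex in [theta]. Two observations
    replace the existence theory and the classification of critical points.

    First, turn the curve so that the tangent at its midpoint becomes horizontal:
    with [beta = theta (L / 2)] the angle [phi = theta - beta] vanishes at
    [L / 2], and both end conditions together give that [cos phi] integrates to
    [l cos beta], which is at most [l].

    Secondly, the energy is convex in the function [c = cos phi]: its integrand is
    [c'^2 / (1 - c^2)], which is jointly convex because [1 - c^2] is concave. So a
    solution of the Euler-Lagrange equation whose angle vanishes at [L / 2] is a
    minimizer among all [phi] that vanish there and have the same or a smaller
    integral of the cosine. The candidate is half a period of the pendulum
    equation [theta'' = - lam sin theta] with vanishing curvature at both ends
    and [lam > 0].

    The convexity inequality is used as an exact identity. Let [C], [S], [K] be
    the cosine, the sine and the derivative of the angle of the candidate, let
    [sg = sin phi] and [k = phi'], and put [m = - K / S]. Then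
    [k^2 - K^2 = (k + m sg)^2 + m^2 (c - C)^2 - 2 lam (c - C) + (2 m (c - C))'].
    The function [m] has a pole at the midpoint, but [c - C] vanishes there to
    second order; at the ends [m] vanishes because [K] does. Integration shows
    that the energy exceeds that of the candidate by at least
    [2 lam l (1 - cos beta)] (lemmas [is_derive01_defect], [energy_lower_bound]).
    Equality forces [cos beta = 1], [c = C] and [k^2 = K^2]; since [K] has no zero
    inside, [k] is [K] or [- K] throughout, and the curve is the candidate or its
    reflection ([energy_equality]).

    The curves of the theorem are such half waves ([hat_half_wave]): with the
    amplitude [psi] running from [pi / 2] to [3 pi / 2] one has
    [C = 1 - 2 p^2 sin^2 psi], [S = 2 p sin psi Delta(psi)] and [K] a multiple of
    [cos psi], where [Delta(psi)] is the root of [1 - p^2 sin^2 psi]. The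
    equation [2 E / K - 1 = l / L] for the modulus says that the end point is
    [(l, 0)]; it has exactly one solution since [E] decreases and [K] increases,
    from [pi / 2] to infinity ([hat_p_spec]).

    The curvature of a half wave vanishes at the ends only. It has no loop: the
    ordinate rises strictly up to the midpoint and falls symmetrically, so that
    two points of equal height are mirror images, and their abscissae differ
    ([half_wave_injective]). Finally, two curves running along the same half
    wave differ by the parameter change matching their arc lengths, which is
    smooth by a bootstrap argument ([equal_up_to_reparam_arclength]). *)

(** * Calculus relative to [0,1] *)

(** The retraction of the line onto [0,1]; composing with it turns questions
    about one-sided behaviour at the endpoints into two-sided ones. *)
Definition clamp (t : R) : R := Rmax 0 (Rmin t 1).

Lemma clamp_I01 (t : R) : I01 (clamp t).
Proof.
  unfold clamp, I01, Rmax, Rmin; repeat destruct Rle_dec; lra.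
Qed.

Lemma clamp_id (t : R) : I01 t -> clamp t = t.
Proof.
  unfold clamp, I01, Rmax, Rmin; repeat destruct Rle_dec; lra.
Qed.

Lemma clamp_contraction (t u : R) : Rabs (clamp u - clamp t) <= Rabs (u - t).
Proof.
  unfold clamp, Rmax, Rmin, Rabs;
    repeat destruct Rle_dec; repeat destruct Rcase_abs; lra.
Qed.

Lemma continuous_eps (f : R -> R) (x : R) :
  continuous f x <->
  forall eps, 0 < eps -> exists delta, 0 < delta /\
    forall y, Rabs (y - x) < delta -> Rabs (f y - f x) < eps.
Proof.
  split.
  - intros H eps Heps.
    destruct (proj1 (filterlim_locally _ _) H (mkposreal eps Heps)) as [d Hd].
    exists d; split; [apply cond_pos | intros y Hy; exact (Hd y Hy)].
  - intros H; apply filterlim_locally; intros eps.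
    destruct (H eps (cond_pos eps)) as [d [Hd Hy]].
    exists (mkposreal d Hd); intros y; exact (Hy y).
Qed.

Lemma continuous_clamp (t : R) : continuous clamp t.
Proof.
  apply continuous_eps; intros eps Heps; exists eps; split; [exact Heps|].
  intros y Hy; eapply Rle_lt_trans; [apply clamp_contraction | exact Hy].
Qed.

Lemma is_derive01_eps (f : R -> R) (t d : R) :
  is_derive01 f t d <->
  forall eps, 0 < eps -> exists delta, 0 < delta /\
    forall u, I01 u -> Rabs (u - t) < delta ->
      Rabs (f u - f t - d * (u - t)) <= eps * Rabs (u - t).
Proof.
  unfold is_derive01; split.
  - intros H eps Heps.
    destruct (proj1 (filterlim_locally _ _) H (mkposreal eps Heps)) as [r Hr].
    exists r; split; [apply cond_pos|]; intros u Hu Hd.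
    destruct (Req_dec u t) as [->|Hne].
    + replace (f t - f t - d * (t - t)) with 0 by ring.
      rewrite Rabs_R0; apply Rmult_le_pos; [lra | apply Rabs_pos].
    + assert (Hq := Hr u Hd Hne Hu).
      change (Rabs ((f u - f t) / (u - t) - d) < eps) in Hq.
      replace (f u - f t - d * (u - t))
        with (((f u - f t) / (u - t) - d) * (u - t)) by (field; lra).
      rewrite Rabs_mult; apply Rmult_le_compat_r; [apply Rabs_pos | lra].
  - intros H; apply filterlim_locally; intros eps.
    destruct (H (eps / 2)) as [r [Hr Hu]]; [destruct eps; simpl; lra|].
    exists (mkposreal r Hr); intros u Hd Hne HI.
    change (Rabs ((f u - f t) / (u - t) - d) < eps).
    assert (Hpos : 0 < Rabs (u - t)) by (apply Rabs_pos_lt; lra).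
    apply Rmult_lt_reg_r with (1 := Hpos); rewrite <- Rabs_mult.
    replace (((f u - f t) / (u - t) - d) * (u - t))
      with (f u - f t - d * (u - t)) by (field; lra).
    eapply Rle_lt_trans; [apply Hu; [exact HI | exact Hd]|].
    destruct eps as [e He]; simpl; nra.
Qed.

Lemma is_derive_eps (f : R -> R) (t d : R) :
  is_derive f t d <->
  forall eps, 0 < eps -> exists delta, 0 < delta /\
    forall u, Rabs (u - t) < delta ->
      Rabs (f u - f t - d * (u - t)) <= eps * Rabs (u - t).
Proof.
  rewrite is_derive_Reals; unfold derivable_pt_lim; split.
  - intros H eps Heps; destruct (H eps Heps) as [r Hr].
    exists r; split; [apply cond_pos|]; intros u Hd.
    destruct (Req_dec u t) as [->|Hne].
    + replace (f t - f t - d * (t - t)) with 0 by ring.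
      rewrite Rabs_R0; apply Rmult_le_pos; [lra | apply Rabs_pos].
    + assert (Hq := Hr (u - t) ltac:(lra) Hd).
      replace (t + (u - t)) with u in Hq by ring.
      replace (f u - f t - d * (u - t))
        with (((f u - f t) / (u - t) - d) * (u - t)) by (field; lra).
      rewrite Rabs_mult; apply Rmult_le_compat_r; [apply Rabs_pos | lra].
  - intros H eps Heps.
    destruct (H (eps / 2)) as [r [Hr Hu]]; [lra|].
    exists (mkposreal r Hr); intros h Hne Hd.
    assert (Hpos : 0 < Rabs h) by (apply Rabs_pos_lt; lra).
    apply Rmult_lt_reg_r with (1 := Hpos); rewrite <- Rabs_mult.
    replace (((f (t + h) - f t) / h - d) * h)
      with (f (t + h) - f t - d * (t + h - t)) by (field; lra).
    eapply Rle_lt_trans.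
    + apply Hu; replace (t + h - t) with h by ring; exact Hd.
    + replace (t + h - t) with h by ring; nra.
Qed.

(** Extending [f] beyond an endpoint by its tangent line makes a one-sided
    derivative two-sided; so the usual rules carry over to [0,1]. *)
Lemma is_derive01_extend (f : R -> R) (t d : R) :
  I01 t -> is_derive01 f t d ->
  exists F : R -> R, is_derive F t d /\ forall u, I01 u -> F u = f u.
Proof.
  intros Ht Hf; exists (fun u => f (clamp u) + d * (u - clamp u)); split.
  - apply is_derive_eps; intros eps Heps.
    destruct (proj1 (is_derive01_eps f t d) Hf eps Heps) as [r [Hr Hu]].
    exists r; split; [exact Hr|]; intros u Hd.
    assert (Hc := clamp_contraction t u).
    rewrite (clamp_id t Ht) in *.
    replace (f (clamp u) + d * (u - clamp u) - (f t + d * (t - t)) - d * (u - t))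
      with (f (clamp u) - f t - d * (clamp u - t)) by ring.
    eapply Rle_trans; [apply Hu; [apply clamp_I01 | lra]|].
    apply Rmult_le_compat_l; lra.
  - intros u Hu; rewrite (clamp_id u Hu); ring.
Qed.

Lemma is_derive01_restrict (f F : R -> R) (t d : R) :
  I01 t -> is_derive F t d -> (forall u, I01 u -> F u = f u) ->
  is_derive01 f t d.
Proof.
  intros Ht HF Heq; apply is_derive01_eps; intros eps Heps.
  destruct (proj1 (is_derive_eps F t d) HF eps Heps) as [r [Hr Hu]].
  exists r; split; [exact Hr|]; intros u Iu Hd.
  rewrite <- (Heq u Iu), <- (Heq t Ht); exact (Hu u Hd).
Qed.

Lemma is_derive01_ext (f g : R -> R) (t d : R) :
  I01 t -> (forall u, I01 u -> f u = g u) ->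
  is_derive01 f t d -> is_derive01 g t d.
Proof.
  intros Ht Heq Hf; destruct (is_derive01_extend f t d Ht Hf) as [F [HF HFf]].
  apply is_derive01_restrict with (F := F); auto.
  intros u Hu; rewrite HFf, Heq; auto.
Qed.

Lemma is_derive01_unique (f : R -> R) (t d e : R) :
  I01 t -> is_derive01 f t d -> is_derive01 f t e -> d = e.
Proof.
  intros Ht Hd He; apply Rminus_diag_uniq.
  destruct (Req_dec (d - e) 0) as [|Hne]; [assumption|exfalso].
  assert (Hpos := Rabs_pos_lt _ Hne).
  destruct (proj1 (is_derive01_eps f t d) Hd (Rabs (d - e) / 4))
    as [r1 [Hr1 H1]]; [lra|].
  destruct (proj1 (is_derive01_eps f t e) He (Rabs (d - e) / 4))
    as [r2 [Hr2 H2]]; [lra|].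
  assert (Hu : exists u, I01 u /\ u <> t /\ Rabs (u - t) < Rmin r1 r2).
  { assert (Hm : 0 < Rmin r1 r2) by (apply Rmin_pos; assumption).
    set (h := Rmin (1 / 2) (Rmin r1 r2 / 2)).
    assert (Hh : 0 < h <= 1 / 2 /\ h < Rmin r1 r2).
    { unfold h; split; [split|].
      - apply Rmin_pos; lra.
      - apply Rmin_l.
      - eapply Rle_lt_trans; [apply Rmin_r | lra]. }
    unfold I01 in *.
    destruct (Rle_dec t (1 / 2)).
    - exists (t + h); split; [lra|]; split; [lra|].
      replace (t + h - t) with h by ring; rewrite Rabs_pos_eq; lra.
    - exists (t - h); split; [lra|]; split; [lra|].
      replace (t - h - t) with (- h) by ring.
      rewrite Rabs_Ropp, Rabs_pos_eq; lra. }
  destruct Hu as [u [Iu [Hut Hur]]].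
  assert (B1 := H1 u Iu (Rlt_le_trans _ _ _ Hur (Rmin_l _ _))).
  assert (B2 := H2 u Iu (Rlt_le_trans _ _ _ Hur (Rmin_r _ _))).
  assert (Hp : 0 < Rabs (u - t)) by (apply Rabs_pos_lt; lra).
  assert (B3 : Rabs (d - e) * Rabs (u - t) <= Rabs (d - e) / 2 * Rabs (u - t)).
  { rewrite <- Rabs_mult.
    replace ((d - e) * (u - t))
      with ((f u - f t - e * (u - t)) + - (f u - f t - d * (u - t))) by ring.
    eapply Rle_trans; [apply Rabs_triang|]; rewrite Rabs_Ropp; lra. }
  nra.
Qed.

Lemma Derive01_unique (f : R -> R) (t d : R) :
  I01 t -> is_derive01 f t d -> Derive01 f t = d.
Proof.
  intros Ht Hd; unfold Derive01.
  apply (iota_unique (fun d0 : R => is_derive01 f t d0)); [|exact Hd].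
  intros e He; exact (is_derive01_unique f t e d Ht He Hd).
Qed.

Lemma Derive01_correct (f : R -> R) (t : R) :
  I01 t -> (exists d, is_derive01 f t d) -> is_derive01 f t (Derive01 f t).
Proof.
  intros Ht [d Hd]; rewrite (Derive01_unique f t d Ht Hd); exact Hd.
Qed.

Lemma is_derive01_of_R (f : R -> R) (t d : R) :
  I01 t -> is_derive f t d -> is_derive01 f t d.
Proof.
  intros Ht Hf; apply is_derive01_restrict with (F := f); auto.
Qed.

Lemma is_derive01_const (a t : R) : I01 t -> is_derive01 (fun _ => a) t 0.
Proof.
  intros Ht; apply is_derive01_of_R; auto; apply is_derive_Reals, derivable_pt_lim_const.
Qed.

Lemma is_derive01_plus (f g : R -> R) (t d e : R) :
  I01 t -> is_derive01 f t d -> is_derive01 g t e ->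
  is_derive01 (fun u => f u + g u) t (d + e).
Proof.
  intros Ht Hf Hg.
  destruct (is_derive01_extend f t d Ht Hf) as [F [HF EF]].
  destruct (is_derive01_extend g t e Ht Hg) as [G [HG EG]].
  apply is_derive01_restrict with (F := fun u => F u + G u); auto.
  - exact (is_derive_plus F G t d e HF HG).
  - intros u Hu; rewrite EF, EG; auto.
Qed.

Lemma is_derive01_mult (f g : R -> R) (t d e : R) :
  I01 t -> is_derive01 f t d -> is_derive01 g t e ->
  is_derive01 (fun u => f u * g u) t (d * g t + f t * e).
Proof.
  intros Ht Hf Hg.
  destruct (is_derive01_extend f t d Ht Hf) as [F [HF EF]].
  destruct (is_derive01_extend g t e Ht Hg) as [G [HG EG]].
  apply is_derive01_restrict with (F := fun u => F u * G u); auto.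
  - rewrite <- (EF t Ht), <- (EG t Ht).
    exact (Derive.is_derive_mult F G t d e HF HG).
  - intros u Hu; rewrite EF, EG; auto.
Qed.

Lemma is_derive01_comp (F f : R -> R) (t d e : R) :
  I01 t -> is_derive F (f t) e -> is_derive01 f t d ->
  is_derive01 (fun u => F (f u)) t (d * e).
Proof.
  intros Ht HF Hf.
  destruct (is_derive01_extend f t d Ht Hf) as [G [HG EG]].
  apply is_derive01_restrict with (F := fun u => F (G u)); auto.
  - rewrite <- (EG t Ht) in HF; exact (is_derive_comp F G t e d HF HG).
  - intros u Hu; rewrite EG; auto.
Qed.

Lemma is_derive01_comp01 (f g : R -> R) (t d e : R) :
  I01 t -> (forall u, I01 u -> I01 (g u)) ->
  is_derive01 f (g t) e -> is_derive01 g t d ->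
  is_derive01 (fun u => f (g u)) t (d * e).
Proof.
  intros Ht Hr Hf Hg.
  destruct (is_derive01_extend f (g t) e (Hr t Ht) Hf) as [F [HF EF]].
  apply is_derive01_ext with (f := fun u => F (g u)); auto.
  apply is_derive01_comp; auto.
Qed.

Lemma is_derive01_value (f : R -> R) (t d e : R) :
  is_derive01 f t d -> d = e -> is_derive01 f t e.
Proof. intros H <-; exact H. Qed.

Lemma is_derive01_opp (f : R -> R) (t d : R) :
  I01 t -> is_derive01 f t d -> is_derive01 (fun u => - f u) t (- d).
Proof.
  intros Ht Hf.
  apply is_derive01_value with (d := d * -1); [|ring].
  apply (is_derive01_comp (fun x => - x)); auto.
  auto_derive; auto.
Qed.

Lemma is_derive01_minus (f g : R -> R) (t d e : R) :
  I01 t -> is_derive01 f t d -> is_derive01 g t e ->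
  is_derive01 (fun u => f u - g u) t (d - e).
Proof.
  intros Ht Hf Hg; apply is_derive01_plus; auto; apply is_derive01_opp; auto.
Qed.

Lemma is_derive01_scal (a : R) (f : R -> R) (t d : R) :
  I01 t -> is_derive01 f t d -> is_derive01 (fun u => a * f u) t (a * d).
Proof.
  intros Ht Hf.
  apply is_derive01_value with (d := d * a); [|ring].
  apply (is_derive01_comp (fun x => a * x)); auto.
  auto_derive; auto; ring.
Qed.

Lemma is_derive01_inv (f : R -> R) (t d : R) :
  I01 t -> f t <> 0 -> is_derive01 f t d ->
  is_derive01 (fun u => / f u) t (- d * (/ f t * / f t)).
Proof.
  intros Ht H0 Hf.
  apply is_derive01_value with (d := d * - (/ f t * / f t)); [|ring].
  apply (is_derive01_comp Rinv); auto.
  auto_derive; auto; field; auto.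
Qed.

Lemma is_derive01_sqrt (f : R -> R) (t d : R) :
  I01 t -> 0 < f t -> is_derive01 f t d ->
  is_derive01 (fun u => sqrt (f u)) t (d * (1 / 2 * / sqrt (f t))).
Proof.
  intros Ht H0 Hf; apply (is_derive01_comp sqrt); auto.
  assert (0 < sqrt (f t)) by (apply sqrt_lt_R0; auto).
  auto_derive; auto; field; lra.
Qed.

(** Continuity on [0,1] as continuity on the line of the extension by constants. *)
Definition continuous01 (f : R -> R) : Prop :=
  forall t, continuous (fun u => f (clamp u)) t.

Lemma continuous01_of_derive (f : R -> R) :
  (forall t, I01 t -> exists d, is_derive01 f t d) -> continuous01 f.
Proof.
  intros H t; destruct (H (clamp t) (clamp_I01 t)) as [d Hd].
  destruct (is_derive01_extend f (clamp t) d (clamp_I01 t) Hd) as [F [HF EF]].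
  apply continuous_ext with (f := fun u => F (clamp u)).
  - intros u; apply EF, clamp_I01.
  - apply continuous_comp; [apply continuous_clamp|].
    apply (ex_derive_continuous F); exists d; exact HF.
Qed.

Lemma is_derive01_interior (f : R -> R) (t d : R) :
  0 < t < 1 -> is_derive01 f t d -> is_derive (fun u => f (clamp u)) t d.
Proof.
  intros Ht Hf; assert (It : I01 t) by (unfold I01; lra).
  destruct (is_derive01_extend f t d It Hf) as [F [HF EF]].
  apply is_derive_ext_loc with (f := F); [|exact HF].
  assert (Hr : 0 < Rmin t (1 - t)) by (apply Rmin_pos; lra).
  exists (mkposreal _ Hr); intros u Hu.
  change (Rabs (u - t) < Rmin t (1 - t)) in Hu.
  assert (H1 := Rmin_l t (1 - t)); assert (H2 := Rmin_r t (1 - t)).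
  apply Rabs_def2 in Hu.
  assert (Iu : I01 u) by (unfold I01; lra).
  rewrite clamp_id; auto.
Qed.

Lemma continuous01_mvt (f d : R -> R) (a b : R) :
  0 <= a -> a < b -> b <= 1 -> continuous01 f ->
  (forall t, a < t < b -> is_derive01 f t (d t)) ->
  exists t, a < t < b /\ f b - f a = d t * (b - a).
Proof.
  intros Ha Hab Hb Hf Hd.
  set (F := fun u => f (clamp u)).
  assert (HF : forall c, a < c < b -> derivable_pt_lim F c (d c)).
  { intros c Hc; apply is_derive_Reals.
    apply (is_derive01_interior f); [lra | auto]. }
  assert (pF : forall c, a < c < b -> derivable_pt F c).
  { intros c Hc; exact (exist _ (d c) (HF c Hc)). }
  assert (pI : forall c, a < c < b -> derivable_pt id c).
  { intros c _; apply derivable_pt_id. }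
  destruct (MVT F id a b pF pI Hab) as [c [P HP]].
  - intros c _; apply continuity_pt_filterlim; apply Hf.
  - intros c _; apply derivable_continuous_pt, derivable_pt_id.
  - exists c; split; [exact P|].
    rewrite (derive_pt_eq_0 F c (d c) (pF c P) (HF c P)) in HP.
    rewrite (derive_pt_eq_0 id c 1 (pI c P) (derivable_pt_lim_id c)) in HP.
    unfold F, id in HP.
    rewrite !clamp_id in HP by (unfold I01; lra); lra.
Qed.

Lemma nondecreasing01 (f d : R -> R) (a b : R) :
  0 <= a -> a <= b -> b <= 1 -> continuous01 f ->
  (forall t, a < t < b -> is_derive01 f t (d t)) ->
  (forall t, a < t < b -> 0 <= d t) -> f a <= f b.
Proof.
  intros Ha [Hab|<-] Hb Hf Hd Hpos; [|lra].
  destruct (continuous01_mvt f d a b) as [c [Hc E]]; auto.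
  assert (0 <= d c * (b - a)) by (apply Rmult_le_pos; [auto | lra]); lra.
Qed.

Lemma increasing01 (f d : R -> R) (a b : R) :
  0 <= a -> a < b -> b <= 1 -> continuous01 f ->
  (forall t, a < t < b -> is_derive01 f t (d t)) ->
  (forall t, a < t < b -> 0 < d t) -> f a < f b.
Proof.
  intros Ha Hab Hb Hf Hd Hpos.
  destruct (continuous01_mvt f d a b) as [c [Hc E]]; auto.
  assert (0 < d c * (b - a)) by (apply Rmult_lt_0_compat; [auto | lra]); lra.
Qed.

(** Being monotone with equal end values, [f] is constant; this is how equality
    in the energy bound is exploited. *)
Lemma nondecreasing01_rigid (f d : R -> R) (a b : R) :
  0 <= a -> b <= 1 -> continuous01 f ->
  (forall t, a < t < b -> is_derive01 f t (d t)) ->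
  (forall t, a < t < b -> 0 <= d t) -> f a = f b ->
  forall t, a < t < b -> d t = 0.
Proof.
  intros Ha Hb Hf Hd Hpos Hab t Ht.
  assert (Hc : forall u, a < u < b -> f u = f a).
  { intros u Hu; apply Rle_antisym.
    - rewrite Hab; apply (nondecreasing01 f d); try lra; auto;
        intros v Hv; first [apply Hd | apply Hpos]; lra.
    - apply (nondecreasing01 f d); try lra; auto;
        intros v Hv; first [apply Hd | apply Hpos]; lra. }
  assert (It : 0 < t < 1) by lra.
  assert (H := is_derive01_interior f t (d t) It (Hd t Ht)).
  assert (H0 : is_derive (fun u => f (clamp u)) t 0).
  { apply is_derive_ext_loc with (f := fun _ => f a).
    - assert (Hr : 0 < Rmin (t - a) (b - t)) by (apply Rmin_pos; lra).
      exists (mkposreal _ Hr); intros u Hu.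
      change (Rabs (u - t) < Rmin (t - a) (b - t)) in Hu.
      assert (H1 := Rmin_l (t - a) (b - t)).
      assert (H2 := Rmin_r (t - a) (b - t)).
      apply Rabs_def2 in Hu.
      rewrite clamp_id by (unfold I01; lra); rewrite (Hc u); [reflexivity | lra].
    - auto_derive; auto. }
  rewrite <- (is_derive_unique _ _ _ H); exact (is_derive_unique _ _ _ H0).
Qed.

Lemma constant01 (f : R -> R) (a b : R) :
  0 <= a -> a <= b -> b <= 1 -> continuous01 f ->
  (forall t, a < t < b -> is_derive01 f t 0) -> f a = f b.
Proof.
  intros Ha [Hab|<-] Hb Hf Hd; [|reflexivity].
  destruct (continuous01_mvt f (fun _ => 0) a b) as [c [Hc E]]; auto; lra.
Qed.

Lemma equal01_of_derive (f g d : R -> R) :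
  f 0 = g 0 ->
  (forall t, I01 t -> is_derive01 f t (d t)) ->
  (forall t, I01 t -> is_derive01 g t (d t)) ->
  forall t, I01 t -> f t = g t.
Proof.
  intros H0 Hf Hg t Ht.
  assert (Hd : forall u, I01 u -> is_derive01 (fun v => f v - g v) u 0).
  { intros u Hu; apply is_derive01_value with (d := d u - d u); [|ring].
    apply is_derive01_minus; auto. }
  assert (E : f 0 - g 0 = f t - g t).
  { apply (constant01 (fun v => f v - g v)); unfold I01 in *; try lra.
    - apply continuous01_of_derive; intros u Hu; exists 0; auto.
    - intros u Hu; apply Hd; unfold I01; lra. }
  lra.
Qed.

Lemma ivt01 (f : R -> R) (a b y : R) :
  I01 a -> I01 b -> a <= b -> continuous01 f ->
  (f a <= y <= f b \/ f b <= y <= f a) ->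
  exists t, a <= t <= b /\ f t = y.
Proof.
  intros Ha Hb Hab Hf Hy.
  destruct (IVT_gen_consistent (fun u => f (clamp u)) a b y) as [t [Ht E]].
  - exact Hf.
  - rewrite (clamp_id a Ha), (clamp_id b Hb).
    unfold Rmin, Rmax; repeat destruct Rle_dec; lra.
  - rewrite Rmin_left, Rmax_right in Ht by assumption.
    exists t; split; [exact Ht|].
    rewrite clamp_id in E; auto; unfold I01 in *; lra.
Qed.

Lemma RInt_clamp (f : R -> R) (t : R) :
  I01 t -> RInt f 0 t = RInt (fun u => f (clamp u)) 0 t.
Proof.
  intros Ht; apply RInt_ext; intros u Hu; unfold I01 in Ht.
  rewrite Rmin_left, Rmax_right in Hu by lra.
  rewrite clamp_id; auto; unfold I01; lra.
Qed.

Lemma is_derive_primitive (f : R -> R) (t : R) :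
  (forall u, continuous f u) -> is_derive (fun u => RInt f 0 u) t (f t).
Proof.
  intros Hf; apply (is_derive_RInt f _ 0); auto.
  apply filter_forall; intros u; apply (@RInt_correct R_CompleteNormedModule).
  apply (@ex_RInt_continuous R_CompleteNormedModule); auto.
Qed.

Lemma is_derive01_RInt (f : R -> R) (t : R) :
  continuous01 f -> I01 t -> is_derive01 (fun u => RInt f 0 u) t (f t).
Proof.
  intros Hf Ht.
  apply is_derive01_restrict
    with (F := fun u => RInt (fun v => f (clamp v)) 0 u); auto.
  - assert (H := is_derive_primitive (fun v => f (clamp v)) t Hf).
    simpl in H; rewrite (clamp_id t Ht) in H; exact H.
  - intros u Hu; symmetry; apply RInt_clamp; auto.
Qed.

Lemma RInt01_derive (F f : R -> R) :
  continuous01 f -> (forall t, I01 t -> is_derive01 F t (f t)) ->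
  forall t, I01 t -> RInt f 0 t = F t - F 0.
Proof.
  intros Hf HF; apply equal01_of_derive with (d := f).
  - rewrite RInt_point; unfold zero; simpl; ring.
  - intros t Ht; apply is_derive01_RInt; auto.
  - intros t Ht; apply is_derive01_value with (d := f t - 0); [|ring].
    apply is_derive01_minus; auto; apply is_derive01_const; auto.
Qed.

(** Used to recover identities at the endpoints and at the midpoint of a curve,
    where the calibration says nothing. *)
Lemma continuous01_zero (f : R -> R) (t0 : R) :
  continuous01 f ->
  (forall t, 0 < t < 1 -> t <> t0 -> f t = 0) ->
  forall t, I01 t -> f t = 0.
Proof.
  intros Hf H0 t Ht.
  destruct (Req_dec (f t) 0) as [|Hne]; [assumption|exfalso].
  assert (Hpos := Rabs_pos_lt _ Hne).
  destruct (proj1 (continuous_eps _ t) (Hf t) _ Hpos) as [r [Hr Hc]].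
  assert (Hu : exists u, 0 < u < 1 /\ u <> t0 /\ Rabs (u - t) < r).
  { set (h := Rmin (1 / 3) (r / 3)).
    assert (Hh : 0 < h <= 1 / 3 /\ h <= r / 3).
    { unfold h; split; [split|].
      - apply Rmin_pos; lra.
      - apply Rmin_l.
      - apply Rmin_r. }
    unfold I01 in Ht.
    destruct (Rle_dec t (1 / 2)) as [Hl|Hl].
    - destruct (Req_dec (t + h) t0).
      + exists (t + h / 2); split; [lra|]; split; [lra|].
        replace (t + h / 2 - t) with (h / 2) by ring; rewrite Rabs_pos_eq; lra.
      + exists (t + h); split; [lra|]; split; [lra|].
        replace (t + h - t) with h by ring; rewrite Rabs_pos_eq; lra.
    - destruct (Req_dec (t - h) t0).
      + exists (t - h / 2); split; [lra|]; split; [lra|].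
        replace (t - h / 2 - t) with (- (h / 2)) by ring.
        rewrite Rabs_Ropp, Rabs_pos_eq; lra.
      + exists (t - h); split; [lra|]; split; [lra|].
        replace (t - h - t) with (- h) by ring.
        rewrite Rabs_Ropp, Rabs_pos_eq; lra. }
  destruct Hu as [u [Iu [Hut Hur]]].
  specialize (Hc u Hur); simpl in Hc.
  rewrite (clamp_id t Ht), clamp_id in Hc by (unfold I01; lra).
  rewrite (H0 u Iu Hut) in Hc; replace (0 - f t) with (- f t) in Hc by ring.
  rewrite Rabs_Ropp in Hc; lra.
Qed.

(** A quotient whose numerator vanishes to second order at a simple zero of
    the denominator extends continuously; division by zero giving zero, the
    quotient already has the right value there. *)
Lemma quotient_continuous01 (f g : R -> R) (t0 e : R) :
  I01 t0 ->
  (forall t, I01 t -> exists d, is_derive01 f t d) ->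
  (forall t, I01 t -> exists d, is_derive01 g t d) ->
  (forall t, I01 t -> t <> t0 -> g t <> 0) ->
  f t0 = 0 -> g t0 = 0 -> is_derive01 f t0 0 -> is_derive01 g t0 e -> e <> 0 ->
  continuous01 (fun t => f t / g t).
Proof.
  intros I0 Df Dg Hg f0 g0 Df0 Dg0 He t.
  destruct (Req_dec (clamp t) t0) as [Et|Hne].
  - apply continuous_eps; intros eps Heps.
    assert (Hep := Rabs_pos_lt _ He).
    (* near t0 the denominator is at least |e| / 2 times the distance to t0 *)
    assert (Hpos : 0 < eps * (Rabs e / 2) / 2).
    { apply Rdiv_lt_0_compat; [apply Rmult_lt_0_compat|]; lra. }
    destruct (proj1 (is_derive01_eps _ _ _) Df0 _ Hpos) as [r1 [Hr1 H1]].
    assert (Hpos2 : 0 < Rabs e / 2) by lra.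
    destruct (proj1 (is_derive01_eps _ _ _) Dg0 _ Hpos2) as [r2 [Hr2 H2]].
    exists (Rmin r1 r2); split; [apply Rmin_pos; auto|]; intros y Hy.
    assert (Hc := clamp_contraction t y); rewrite Et in *.
    set (u := clamp y) in *; assert (Iu : I01 u) by apply clamp_I01.
    rewrite f0; unfold Rdiv at 2; rewrite Rmult_0_l, Rminus_0_r.
    destruct (Req_dec u t0) as [->|Hu].
    { rewrite f0; unfold Rdiv; rewrite Rmult_0_l, Rabs_R0; auto. }
    assert (Hd : 0 < Rabs (u - t0)) by (apply Rabs_pos_lt; lra).
    assert (Hm1 := Rmin_l r1 r2); assert (Hm2 := Rmin_r r1 r2).
    specialize (H1 u Iu ltac:(lra)); specialize (H2 u Iu ltac:(lra)).
    rewrite f0 in H1; rewrite g0 in H2.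
    replace (f u - 0 - 0 * (u - t0)) with (f u) in H1 by ring.
    rewrite Rminus_0_r in H2.
    assert (H3 : Rabs e / 2 * Rabs (u - t0) <= Rabs (g u)).
    { assert (H4 := Rabs_triang (g u) (- (g u - e * (u - t0)))).
      rewrite Rabs_Ropp in H4.
      replace (g u + - (g u - e * (u - t0))) with (e * (u - t0)) in H4 by ring.
      rewrite Rabs_mult in H4; lra. }
    assert (H5 : 0 < Rabs (g u)) by nra.
    unfold Rdiv; rewrite Rabs_mult, Rabs_inv.
    apply Rmult_lt_reg_r with (Rabs (g u)); auto.
    rewrite Rmult_assoc, Rinv_l, Rmult_1_r by lra.
    apply Rle_lt_trans with (1 := H1); nra.
  - assert (It := clamp_I01 t).
    destruct (Df _ It) as [d Hd]; destruct (Dg _ It) as [d' Hd'].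
    assert (Q := is_derive01_mult _ _ _ _ _ It Hd
                   (is_derive01_inv _ _ _ It (Hg _ It Hne) Hd')).
    destruct (is_derive01_extend _ _ _ It Q) as [F [HF EF]].
    apply continuous_ext with (f := fun u => F (clamp u)).
    + intros u; apply EF, clamp_I01.
    + apply continuous_comp; [apply continuous_clamp|].
      apply (ex_derive_continuous F); eexists; exact HF.
Qed.

Lemma continuous01_minus (f g : R -> R) :
  continuous01 f -> continuous01 g -> continuous01 (fun t => f t - g t).
Proof.
  intros Hf Hg t.
  exact (continuous_minus _ _ t (Hf t) (Hg t)).
Qed.

Lemma continuous01_mult (f g : R -> R) :
  continuous01 f -> continuous01 g -> continuous01 (fun t => f t * g t).
Proof.
  intros Hf Hg t.
  exact (continuous_mult _ _ t (Hf t) (Hg t)).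
Qed.

Lemma sign_constant01 (f : R -> R) :
  continuous01 f -> (forall t, 0 < t < 1 -> f t <> 0) -> f (1 / 2) < 0 ->
  forall t, 0 < t < 1 -> f t < 0.
Proof.
  intros Hc Hne Hm t Ht.
  destruct (Rlt_dec (f t) 0) as [|H]; auto; exfalso.
  destruct (Rle_dec t (1 / 2)) as [H1|H1].
  - destruct (ivt01 f t (1 / 2) 0) as [r [Hr E]]; unfold I01; try lra; auto.
    apply (Hne r); lra.
  - destruct (ivt01 f (1 / 2) t 0) as [r [Hr E]]; unfold I01; try lra; auto.
    apply (Hne r); lra.
Qed.

Lemma is_derive01_dilate (F : R -> R) (a t d : R) :
  I01 t -> is_derive F (a * t) d -> is_derive01 (fun r => F (a * r)) t (a * d).
Proof.
  intros Ht HF; apply (is_derive01_comp F (fun r => a * r)); auto.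
  apply is_derive01_of_R; auto; auto_derive; auto; ring.
Qed.

(** * Smooth functions on [0,1] *)

(** A form of differentiability [n] times that lends itself to induction,
    since it does not refer to the chosen derivative [Derive01]. *)
Fixpoint differentiable01 (n : nat) (f : R -> R) : Prop :=
  match n with
  | O => True
  | S k => exists d : R -> R,
      (forall t, I01 t -> is_derive01 f t (d t)) /\ differentiable01 k d
  end.

Lemma differentiable01_ext (n : nat) (f g : R -> R) :
  (forall t, I01 t -> f t = g t) -> differentiable01 n f -> differentiable01 n g.
Proof.
  destruct n as [|n]; simpl; auto.
  intros Heq [d [Hd Hn]]; exists d; split; auto.
  intros t Ht; apply is_derive01_ext with (f := f); auto.
Qed.

Lemma differentiable01_pred (n : nat) (f : R -> R) :
  differentiable01 (S n) f -> differentiable01 n f.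
Proof.
  revert f; induction n as [|n IH]; intros f; [simpl; auto|].
  intros [d [Hd Hn]]; exists d; split; auto.
Qed.

Lemma Derive01_n_shift (f : R -> R) (n : nat) :
  Derive01_n (Derive01 f) n = Derive01_n f (S n).
Proof.
  induction n as [|n IH]; [reflexivity|].
  change (Derive01 (Derive01_n (Derive01 f) n) = Derive01 (Derive01_n f (S n))).
  rewrite IH; reflexivity.
Qed.

Lemma smooth01_Derive01 (f : R -> R) :
  smooth01 f -> smooth01 (Derive01 f).
Proof.
  intros H n t Ht; rewrite Derive01_n_shift; apply (H (S n) t Ht).
Qed.

Lemma smooth01_is_derive01 (f : R -> R) (t : R) :
  smooth01 f -> I01 t -> is_derive01 f t (Derive01 f t).
Proof.
  intros H Ht; apply Derive01_correct; auto; exact (H O t Ht).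
Qed.

Lemma smooth01_differentiable (f : R -> R) :
  smooth01 f <-> forall n, differentiable01 n f.
Proof.
  split.
  - intros H n; revert f H; induction n as [|n IH]; intros f H; [exact I|].
    exists (Derive01 f); split.
    + intros t Ht; apply smooth01_is_derive01; auto.
    + apply IH, smooth01_Derive01; auto.
  - intros H n; revert f H; induction n as [|n IH]; intros f H t Ht.
    + destruct (H 1%nat) as [d [Hd _]]; exists (d t); apply Hd; auto.
    + rewrite <- Derive01_n_shift; apply IH; auto.
      intros m; destruct (H (S m)) as [d [Hd Hm]].
      apply differentiable01_ext with (f := d); auto.
      intros u Hu; symmetry; apply Derive01_unique; auto.
Qed.

Lemma smooth01_ext (f g : R -> R) :
  (forall t, I01 t -> f t = g t) -> smooth01 f -> smooth01 g.
Proof.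
  rewrite !smooth01_differentiable; intros Heq H n.
  apply differentiable01_ext with (f := f); auto.
Qed.

Lemma smooth01_continuous (f : R -> R) : smooth01 f -> continuous01 f.
Proof.
  intros H; apply continuous01_of_derive; intros t Ht; exact (H O t Ht).
Qed.

Lemma differentiable01_const (n : nat) (a : R) : differentiable01 n (fun _ => a).
Proof.
  revert a; induction n as [|n IH]; intros a; [exact I|].
  exists (fun _ => 0); split; auto.
  intros t Ht; apply is_derive01_const; auto.
Qed.

Lemma differentiable01_plus (n : nat) (f g : R -> R) :
  differentiable01 n f -> differentiable01 n g ->
  differentiable01 n (fun t => f t + g t).
Proof.
  revert f g; induction n as [|n IH]; intros f g; [auto|].
  intros [d [Hd Hn]] [e [He Hm]]; exists (fun t => d t + e t); split; auto.
  intros t Ht; apply is_derive01_plus; auto.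
Qed.

Lemma differentiable01_mult (n : nat) (f g : R -> R) :
  differentiable01 n f -> differentiable01 n g ->
  differentiable01 n (fun t => f t * g t).
Proof.
  revert f g; induction n as [|n IH]; intros f g; [auto|].
  intros Hf Hg; assert (Pf := differentiable01_pred n f Hf).
  assert (Pg := differentiable01_pred n g Hg).
  destruct Hf as [d [Hd Hn]]; destruct Hg as [e [He Hm]].
  exists (fun t => d t * g t + f t * e t); split.
  - intros t Ht; apply is_derive01_mult; auto.
  - apply differentiable01_plus; auto.
Qed.

Lemma differentiable01_inv (n : nat) (f : R -> R) :
  (forall t, I01 t -> f t <> 0) ->
  differentiable01 n f -> differentiable01 n (fun t => / f t).
Proof.
  intros H0; induction n as [|n IH]; intros Hf; [exact I|].
  assert (Pf := IH (differentiable01_pred n f Hf)).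
  destruct Hf as [d [Hd Hn]].
  exists (fun t => (-1 * d t) * (/ f t * / f t)); split.
  - intros t Ht.
    apply is_derive01_value with (d := - d t * (/ f t * / f t)); [|ring].
    apply is_derive01_inv; auto.
  - repeat apply differentiable01_mult; auto; apply differentiable01_const.
Qed.

Lemma differentiable01_sqrt (n : nat) (f : R -> R) :
  (forall t, I01 t -> 0 < f t) ->
  differentiable01 n f -> differentiable01 n (fun t => sqrt (f t)).
Proof.
  intros H0; induction n as [|n IH]; intros Hf; [exact I|].
  assert (Pf := IH (differentiable01_pred n f Hf)).
  destruct Hf as [d [Hd Hn]].
  exists (fun t => d t * (1 / 2 * / sqrt (f t))); split.
  - intros t Ht; apply is_derive01_sqrt; auto.
    apply differentiable01_mult; auto.
    apply differentiable01_mult; [apply differentiable01_const|].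
    apply differentiable01_inv; auto.
    intros t Ht; apply Rgt_not_eq, sqrt_lt_R0; auto.
Qed.

Lemma differentiable01_comp (n : nat) (f g : R -> R) :
  (forall t, I01 t -> I01 (g t)) ->
  differentiable01 n f -> differentiable01 n g ->
  differentiable01 n (fun t => f (g t)).
Proof.
  intros Hr; revert f; induction n as [|n IH]; intros f; [auto|].
  intros [d [Hd Hn]] Hg; assert (Pg := differentiable01_pred n g Hg).
  destruct Hg as [e [He Hm]].
  exists (fun t => e t * d (g t)); split.
  - intros t Ht; apply is_derive01_comp01; auto.
  - apply differentiable01_mult; auto.
Qed.

Lemma differentiable01_scal (n : nat) (a : R) (f : R -> R) :
  differentiable01 n f -> differentiable01 n (fun t => a * f t).
Proof.
  intros H; apply (differentiable01_mult n (fun _ => a)); auto.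
  apply differentiable01_const.
Qed.

Lemma smooth01_const (a : R) : smooth01 (fun _ => a).
Proof.
  apply smooth01_differentiable; intros n; apply differentiable01_const.
Qed.

Lemma smooth01_plus (f g : R -> R) :
  smooth01 f -> smooth01 g -> smooth01 (fun t => f t + g t).
Proof.
  rewrite !smooth01_differentiable; intros Hf Hg n.
  apply differentiable01_plus; auto.
Qed.

Lemma smooth01_mult (f g : R -> R) :
  smooth01 f -> smooth01 g -> smooth01 (fun t => f t * g t).
Proof.
  rewrite !smooth01_differentiable; intros Hf Hg n.
  apply differentiable01_mult; auto.
Qed.

Lemma smooth01_opp (f : R -> R) : smooth01 f -> smooth01 (fun t => - f t).
Proof.
  intros Hf; apply smooth01_ext with (f := fun t => -1 * f t).
  - intros t _; ring.
  - apply smooth01_mult; auto; apply smooth01_const.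
Qed.

Lemma smooth01_inv (f : R -> R) :
  (forall t, I01 t -> f t <> 0) -> smooth01 f -> smooth01 (fun t => / f t).
Proof.
  rewrite !smooth01_differentiable; intros H0 Hf n.
  apply differentiable01_inv; auto.
Qed.

Lemma smooth01_sqrt (f : R -> R) :
  (forall t, I01 t -> 0 < f t) -> smooth01 f -> smooth01 (fun t => sqrt (f t)).
Proof.
  rewrite !smooth01_differentiable; intros H0 Hf n.
  apply differentiable01_sqrt; auto.
Qed.

Lemma smooth01_of_derive (f d : R -> R) :
  (forall t, I01 t -> is_derive01 f t (d t)) -> smooth01 d -> smooth01 f.
Proof.
  rewrite !smooth01_differentiable; intros Hd H n.
  apply differentiable01_pred; exists d; auto.
Qed.

(** * Elliptic integrals and the amplitude *)

Lemma is_derive_value (f : R -> R) (x d e : R) :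
  is_derive f x d -> d = e -> is_derive f x e.
Proof. intros H <-; exact H. Qed.

Lemma equal_of_derive (f g d : R -> R) (a : R) :
  f a = g a -> (forall x, is_derive f x (d x)) ->
  (forall x, is_derive g x (d x)) -> forall x, f x = g x.
Proof.
  intros Ha Hf Hg x.
  assert (Hd : forall y, is_derive (fun z => f z - g z) y (d y - d y)).
  { intros y; apply (is_derive_minus f g y); auto. }
  destruct (MVT_gen (fun z => f z - g z) a x (fun y => d y - d y))
    as [c [_ Hc]].
  - intros y _; apply Hd.
  - intros y _; apply derivable_continuous_pt; exists (d y - d y).
    apply is_derive_Reals, Hd.
  - simpl in Hc; lra.
Qed.

Lemma increasing_of_derive (f d : R -> R) (a b : R) :
  a < b -> (forall x, is_derive f x (d x)) ->
  (forall x, a < x < b -> 0 < d x) -> f a < f b.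
Proof.
  intros Hab Hf Hd.
  destruct (MVT_cor2 f d a b Hab) as [c [Hc Ic]].
  - intros c _; apply is_derive_Reals; auto.
  - assert (0 < d c * (b - a)) by (apply Rmult_lt_0_compat; [auto | lra]); lra.
Qed.

Definition ellDelta (p theta : R) : R := sqrt (1 - p ^ 2 * sin theta ^ 2).

Lemma sin_sqr_le (theta : R) : 0 <= sin theta ^ 2 <= 1.
Proof.
  assert (H := sin2_cos2 theta); unfold Rsqr in H; nra.
Qed.

Lemma ellDelta_sqr_lb (p theta : R) :
  0 <= p -> 1 - p ^ 2 <= 1 - p ^ 2 * sin theta ^ 2 <= 1.
Proof.
  intros Hp; assert (H := sin_sqr_le theta).
  assert (0 <= p ^ 2) by (apply pow2_ge_0); nra.
Qed.

Lemma ellDelta_arg_pos (p theta : R) : 0 <= p < 1 -> 0 < 1 - p ^ 2 * sin theta ^ 2.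
Proof. intros Hp; assert (H := ellDelta_sqr_lb p theta (proj1 Hp)); nra. Qed.

Lemma ellDelta_pos (p theta : R) : 0 <= p < 1 -> 0 < ellDelta p theta.
Proof. intros Hp; apply sqrt_lt_R0, ellDelta_arg_pos; auto. Qed.

Lemma ellDelta_sqr (p theta : R) :
  0 <= p < 1 -> ellDelta p theta ^ 2 = 1 - p ^ 2 * sin theta ^ 2.
Proof.
  intros Hp; unfold ellDelta; apply pow2_sqrt; left; apply ellDelta_arg_pos; auto.
Qed.

Lemma ellDelta_le_1 (p theta : R) : 0 <= p < 1 -> ellDelta p theta <= 1.
Proof.
  intros Hp; rewrite <- sqrt_1; apply sqrt_le_1_alt.
  apply ellDelta_sqr_lb; lra.
Qed.

Lemma is_derive_ellDelta (p theta : R) :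
  0 <= p < 1 ->
  is_derive (ellDelta p) theta (- p ^ 2 * sin theta * cos theta / ellDelta p theta).
Proof.
  intros Hp; assert (H := ellDelta_arg_pos p theta Hp).
  assert (H0 := ellDelta_pos p theta Hp); unfold ellDelta in *.
  auto_derive.
  - simpl in H; exact H.
  - replace (1 - p * (p * 1) * (sin theta * (sin theta * 1)))
      with (1 - p ^ 2 * sin theta ^ 2) by ring.
    set (s := sqrt _) in *; field; lra.
Qed.

Lemma continuous_ellDelta (p theta : R) : 0 <= p < 1 -> continuous (ellDelta p) theta.
Proof.
  intros Hp; apply (ex_derive_continuous (ellDelta p)).
  eexists; apply is_derive_ellDelta; auto.
Qed.

Lemma continuous_inv_ellDelta (p theta : R) :
  0 <= p < 1 -> continuous (fun t => 1 / ellDelta p t) theta.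
Proof.
  intros Hp; apply (ex_derive_continuous (fun t => 1 / ellDelta p t)).
  assert (H := ellDelta_pos p theta Hp).
  auto_derive; repeat split; [|lra].
  eexists; apply is_derive_ellDelta; auto.
Qed.

(** The incomplete elliptic integral of the second kind. *)
Definition ellEinc (phi p : R) : R := RInt (ellDelta p) 0 phi.

Lemma is_derive_ellF (p phi : R) :
  0 <= p < 1 -> is_derive (fun x => ellF x p) phi (1 / ellDelta p phi).
Proof.
  intros Hp; exact (is_derive_primitive (fun t => 1 / ellDelta p t) phi
                      (fun u => continuous_inv_ellDelta p u Hp)).
Qed.

Lemma is_derive_ellEinc (p phi : R) :
  0 <= p < 1 -> is_derive (fun x => ellEinc x p) phi (ellDelta p phi).
Proof.
  intros Hp; exact (is_derive_primitive (ellDelta p) phi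
                      (fun u => continuous_ellDelta p u Hp)).
Qed.

Lemma RInt_even (h : R -> R) (phi : R) :
  (forall t, continuous h t) -> (forall t, h (- t) = h t) ->
  RInt h 0 (- phi) = - RInt h 0 phi.
Proof.
  intros Hc He; revert phi.
  apply equal_of_derive with (a := 0) (d := fun t => - h t).
  - rewrite Ropp_0, RInt_point; unfold zero; simpl; ring.
  - intros x.
    apply is_derive_value with (d := -1 * h (- x)); [|rewrite He; ring].
    apply (is_derive_comp (fun y => RInt h 0 y) Ropp).
    + apply is_derive_primitive; auto.
    + auto_derive; auto.
  - intros x; apply (is_derive_opp (fun y => RInt h 0 y)).
    apply is_derive_primitive; auto.
Qed.

Lemma RInt_quasiperiodic (h : R -> R) (phi : R) :
  (forall t, continuous h t) -> (forall t, h (- t) = h t) ->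
  (forall t, h (t + PI) = h t) ->
  RInt h 0 (phi + PI) = RInt h 0 phi + 2 * RInt h 0 (PI / 2).
Proof.
  intros Hc He Hp; revert phi.
  apply equal_of_derive with (a := - (PI / 2)) (d := h).
  - rewrite RInt_even by auto.
    replace (- (PI / 2) + PI) with (PI / 2) by field.
    apply Rminus_diag_uniq; ring.
  - intros x.
    apply is_derive_value with (d := 1 * h (x + PI)); [|rewrite Hp; ring].
    apply (is_derive_comp (fun y => RInt h 0 y) (fun y => y + PI)).
    + apply is_derive_primitive; auto.
    + auto_derive; auto.
  - intros x; apply is_derive_value with (d := h x + 0); [|ring].
    apply (is_derive_plus (fun y => RInt h 0 y) (fun _ => 2 * RInt h 0 (PI / 2))).
    + apply is_derive_primitive; auto.
    + exact (is_derive_const (2 * RInt h 0 (PI / 2)) x).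
Qed.

Lemma ellDelta_even (p t : R) : ellDelta p (- t) = ellDelta p t.
Proof.
  unfold ellDelta; rewrite sin_neg; f_equal; ring.
Qed.

Lemma ellDelta_period (p t : R) : ellDelta p (t + PI) = ellDelta p t.
Proof.
  unfold ellDelta; rewrite neg_sin; f_equal; ring.
Qed.

Lemma ellF_odd (p phi : R) : 0 <= p < 1 -> ellF (- phi) p = - ellF phi p.
Proof.
  intros Hp; apply (RInt_even (fun t => 1 / ellDelta p t)).
  - intros t; apply continuous_inv_ellDelta; auto.
  - intros t; rewrite ellDelta_even; reflexivity.
Qed.

Lemma ellF_quasiperiodic (p phi : R) :
  0 <= p < 1 -> ellF (phi + PI) p = ellF phi p + 2 * ellF (PI / 2) p.
Proof.
  intros Hp; apply (RInt_quasiperiodic (fun t => 1 / ellDelta p t)).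
  - intros t; apply continuous_inv_ellDelta; auto.
  - intros t; rewrite ellDelta_even; reflexivity.
  - intros t; rewrite ellDelta_period; reflexivity.
Qed.

Lemma ellEinc_quasiperiodic (p phi : R) :
  0 <= p < 1 -> ellEinc (phi + PI) p = ellEinc phi p + 2 * ellEinc (PI / 2) p.
Proof.
  intros Hp; apply RInt_quasiperiodic.
  - intros t; apply continuous_ellDelta; auto.
  - apply ellDelta_even.
  - apply ellDelta_period.
Qed.

(** Since the integrand of [ellF] is at least 1, its inverse [am] is
    1-Lipschitz. *)
Lemma ellF_expansive (p x y : R) :
  0 <= p < 1 -> x <= y -> y - x <= ellF y p - ellF x p.
Proof.
  intros Hp [Hxy|<-]; [|lra].
  destruct (MVT_cor2 (fun t => ellF t p) (fun t => 1 / ellDelta p t) x y Hxy)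
    as [c [Hc _]].
  - intros c _; apply is_derive_Reals, is_derive_ellF; auto.
  - rewrite Hc.
    assert (H0 := ellDelta_pos p c Hp); assert (H1 := ellDelta_le_1 p c Hp).
    assert (1 <= 1 / ellDelta p c).
    { apply Rmult_le_reg_r with (ellDelta p c); auto.
      unfold Rdiv; rewrite Rmult_assoc, Rinv_l; lra. }
    nra.
Qed.

Lemma ellF_0 (p : R) : ellF 0 p = 0.
Proof. unfold ellF; rewrite RInt_point; reflexivity. Qed.

Lemma ellF_inj (p x y : R) : 0 <= p < 1 -> ellF x p = ellF y p -> x = y.
Proof.
  intros Hp E; destruct (Rle_dec x y) as [H|H].
  - assert (H1 := ellF_expansive p x y Hp H); lra.
  - assert (H1 := ellF_expansive p y x Hp ltac:(lra)); lra.
Qed.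

Lemma ellF_surj (p x : R) : 0 <= p < 1 -> exists phi, ellF phi p = x.
Proof.
  intros Hp.
  destruct (IVT_gen_consistent (fun t => ellF t p) (- Rabs x) (Rabs x) x)
    as [t [_ Ht]].
  - intros t; apply (ex_derive_continuous (fun t => ellF t p)).
    eexists; apply is_derive_ellF; auto.
  - rewrite ellF_odd by auto.
    assert (H := ellF_expansive p 0 (Rabs x) Hp (Rabs_pos x)).
    rewrite ellF_0 in H; assert (H0 := Rabs_pos x).
    rewrite Rmin_left, Rmax_right by lra.
    assert (Hx := Rle_abs x); assert (Hx' := Rle_abs (- x)).
    rewrite Rabs_Ropp in Hx'; lra.
  - exists t; exact Ht.
Qed.

Lemma am_unique (p x phi : R) : 0 <= p < 1 -> ellF phi p = x -> am x p = phi.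
Proof.
  intros Hp H; apply (iota_unique (fun phi : R => ellF phi p = x)); auto.
  intros y Hy; apply (ellF_inj p); auto; lra.
Qed.

Lemma ellF_am (p x : R) : 0 <= p < 1 -> ellF (am x p) p = x.
Proof.
  intros Hp; destruct (ellF_surj p x Hp) as [phi H].
  rewrite (am_unique p x phi); auto.
Qed.

Lemma am_lipschitz (p x y : R) :
  0 <= p < 1 -> Rabs (am y p - am x p) <= Rabs (y - x).
Proof.
  intros Hp.
  rewrite <- (ellF_am p x Hp) at 2; rewrite <- (ellF_am p y Hp) at 2.
  set (a := am x p); set (b := am y p).
  destruct (Rle_dec a b) as [H|H].
  - assert (H1 := ellF_expansive p a b Hp H); rewrite !Rabs_pos_eq; lra.
  - assert (H1 := ellF_expansive p b a Hp ltac:(lra)).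
    rewrite (Rabs_minus_sym b a), (Rabs_minus_sym (ellF b p)).
    rewrite !Rabs_pos_eq; lra.
Qed.

Lemma am_increasing (p x y : R) : 0 <= p < 1 -> x < y -> am x p < am y p.
Proof.
  intros Hp Hxy; destruct (Rlt_dec (am x p) (am y p)) as [|H]; auto.
  assert (H1 := ellF_expansive p (am y p) (am x p) Hp ltac:(lra)).
  rewrite !ellF_am in H1 by auto; lra.
Qed.

Lemma is_derive_am (p x : R) :
  0 <= p < 1 -> is_derive (fun y => am y p) x (ellDelta p (am x p)).
Proof.
  intros Hp; set (D := ellDelta p (am x p)).
  assert (HD : 0 < D) by (apply ellDelta_pos; auto).
  apply is_derive_eps; intros eps Heps.
  destruct (proj1 (is_derive_eps _ _ _) (is_derive_ellF p (am x p) Hp)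
              (eps / D) (Rdiv_lt_0_compat _ _ Heps HD)) as [r [Hr Hu]].
  exists r; split; auto; intros y Hy.
  assert (Hl := am_lipschitz p x y Hp).
  assert (H := Hu (am y p) ltac:(lra)); rewrite !ellF_am in H by auto.
  fold D in H.
  replace (am y p - am x p - D * (y - x))
    with (- D * (y - x - 1 / D * (am y p - am x p))) by (field; lra).
  rewrite Rabs_mult, Rabs_Ropp, (Rabs_pos_eq D) by lra.
  apply Rle_trans with (D * (eps / D * Rabs (am y p - am x p))).
  - apply Rmult_le_compat_l; lra.
  - replace (D * (eps / D * Rabs (am y p - am x p)))
      with (eps * Rabs (am y p - am x p)) by (field; lra).
    apply Rmult_le_compat_l; lra.
Qed.

(** The substitution [z = sin theta] removes the singularity of the complete
    integrals at [z = 1]. *)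
Lemma complete_integral_subst (h : R -> R) (f : R -> R) :
  (forall t, continuous h t) ->
  (forall z, 0 <= z < 1 -> f z = h (asin z) / sqrt (1 - z ^ 2)) ->
  (forall z, 0 <= z < 1 -> continuous f z) ->
  RInt_gen f (at_point 0) (at_left 1) = RInt h 0 (PI / 2).
Proof.
  intros Hh Hf Hc.
  apply (is_RInt_gen_unique); try typeclasses eauto.
  intros P HP.
  set (H := fun y => RInt h 0 y).
  assert (HH : continuous H (PI / 2)).
  { apply (ex_derive_continuous H); eexists; apply is_derive_primitive; auto. }
  destruct HP as [eps HP].
  destruct (proj1 (continuous_eps _ _) HH eps (cond_pos eps)) as [r [Hr Hy]].
  set (b0 := sin (Rmax 0 (PI / 2 - r / 2))).
  assert (HPI := PI_RGT_0).
  assert (Hm : 0 <= Rmax 0 (PI / 2 - r / 2) < PI / 2 /\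
               PI / 2 - r < Rmax 0 (PI / 2 - r / 2)).
  { unfold Rmax; destruct Rle_dec; lra. }
  assert (Hb0 : 0 <= b0 < 1).
  { unfold b0; split; [apply sin_ge_0; lra|].
    rewrite <- sin_PI2; apply sin_increasing_1; lra. }
  exists (fun x => x = 0) (fun b => b0 < b < 1).
  - reflexivity.
  - assert (Hr0 : 0 < 1 - b0) by lra.
    exists (mkposreal _ Hr0); intros u Hu Hu1.
    change (Rabs (u - 1) < 1 - b0) in Hu; apply Rabs_def2 in Hu; lra.
  - intros x b -> Hb; simpl.
    exists (H (asin b)); split.
    + replace (H (asin b)) with (minus (H (asin b)) (H (asin 0))).
      * apply (is_RInt_derive (fun z => H (asin z)) f).
        -- intros z Hz; rewrite Rmin_left, Rmax_right in Hz by lra.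
           rewrite Hf by lra.
           assert (Hz2 : 0 < 1 - z ^ 2) by nra.
           assert (Hs := sqrt_lt_R0 _ Hz2).
           apply is_derive_value with (d := 1 / sqrt (1 - z ^ 2) * h (asin z));
             [|field; lra].
           apply (is_derive_comp H asin).
           ++ apply is_derive_primitive; auto.
           ++ apply is_derive_Reals.
              assert (Hz1 : -1 < z < 1) by lra.
              assert (Hd := derive_pt_asin z Hz1).
              apply derive_pt_eq_1 in Hd.
              replace (1 - z ^ 2) with (1 - z²) by (unfold Rsqr; ring).
              exact Hd.
        -- intros z Hz; rewrite Rmin_left, Rmax_right in Hz by lra.
           apply Hc; lra.
      * rewrite asin_0; unfold H, minus, plus, opp; simpl.
        rewrite RInt_point; unfold zero; simpl; ring.
    + apply HP.
      change (Rabs (H (asin b) - H (PI / 2)) < eps).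
      apply Hy.
      assert (Ha := asin_bound b).
      assert (Rmax 0 (PI / 2 - r / 2) < asin b).
      { apply sin_increasing_0; try lra.
        fold b0; rewrite sin_asin; lra. }
      rewrite Rabs_minus_sym, Rabs_pos_eq; lra.
Qed.

Lemma complete_integrand_continuous (p z : R) :
  0 <= p < 1 -> 0 <= z < 1 ->
  0 < 1 - z ^ 2 /\ 0 < 1 - p ^ 2 * z ^ 2 /\
  continuous (fun z => 1 / (sqrt (1 - z ^ 2) * sqrt (1 - p ^ 2 * z ^ 2))) z /\
  continuous (fun z => sqrt (1 - p ^ 2 * z ^ 2) / sqrt (1 - z ^ 2)) z.
Proof.
  intros Hp Hz.
  assert (H1 : 0 < 1 - z ^ 2) by nra.
  assert (H2 : 0 < 1 - p ^ 2 * z ^ 2).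
  { assert (p ^ 2 * z ^ 2 <= 1 * z ^ 2) by (apply Rmult_le_compat_r; nra); lra. }
  assert (S1 := sqrt_lt_R0 _ H1); assert (S2 := sqrt_lt_R0 _ H2).
  repeat split; auto.
  - apply (ex_derive_continuous
      (fun z => 1 / (sqrt (1 - z ^ 2) * sqrt (1 - p ^ 2 * z ^ 2)))).
    auto_derive.
    replace (1 + - (z * (z * 1))) with (1 - z ^ 2) by ring.
    replace (1 + - (p * (p * 1) * (z * (z * 1))))
      with (1 - p ^ 2 * z ^ 2) by ring.
    repeat split; auto; apply Rgt_not_eq; auto.
    apply Rmult_lt_0_compat; auto.
  - apply (ex_derive_continuous
      (fun z => sqrt (1 - p ^ 2 * z ^ 2) / sqrt (1 - z ^ 2))).
    auto_derive.
    replace (1 + - (z * (z * 1))) with (1 - z ^ 2) by ring.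
    replace (1 + - (p * (p * 1) * (z * (z * 1))))
      with (1 - p ^ 2 * z ^ 2) by ring.
    repeat split; auto; apply Rgt_not_eq; auto.
Qed.

Lemma ellK_ellF (p : R) : 0 <= p < 1 -> ellK p = ellF (PI / 2) p.
Proof.
  intros Hp; unfold ellK.
  rewrite (complete_integral_subst (fun t => 1 / ellDelta p t)); [reflexivity|..].
  - intros t; apply continuous_inv_ellDelta; auto.
  - intros z Hz; unfold ellDelta; rewrite sin_asin by lra.
    destruct (complete_integrand_continuous p z Hp Hz) as [H1 [H2 _]].
    assert (S1 := sqrt_lt_R0 _ H1); assert (S2 := sqrt_lt_R0 _ H2).
    field; lra.
  - intros z Hz; exact (proj1 (proj2 (proj2
      (complete_integrand_continuous p z Hp Hz)))).
Qed.

Lemma ellE_ellEinc (p : R) : 0 <= p < 1 -> ellE p = ellEinc (PI / 2) p.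
Proof.
  intros Hp; unfold ellE.
  rewrite (complete_integral_subst (ellDelta p)); [reflexivity|..].
  - intros t; apply continuous_ellDelta; auto.
  - intros z Hz; unfold ellDelta; rewrite sin_asin by lra; reflexivity.
  - intros z Hz; exact (proj2 (proj2 (proj2
      (complete_integrand_continuous p z Hp Hz)))).
Qed.

Lemma ellK_pos (p : R) : 0 <= p < 1 -> 0 < ellK p.
Proof.
  intros Hp; rewrite ellK_ellF by auto; assert (HPI := PI_RGT_0).
  assert (H := ellF_expansive p 0 (PI / 2) Hp ltac:(lra)).
  rewrite ellF_0 in H; lra.
Qed.

(** * The modulus *)

(** The modulus is the zero of [2 E - c K], [c = 1 + l / L], which is a single
    integral whose integrand decreases with the modulus. *)
Definition modulus_gap (c p : R) : R :=
  RInt (fun t => 2 * ellDelta p t - c * (1 / ellDelta p t)) 0 (PI / 2).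

Lemma continuous_gap_integrand (c p t : R) :
  0 <= p < 1 -> continuous (fun t => 2 * ellDelta p t - c * (1 / ellDelta p t)) t.
Proof.
  intros Hp.
  apply (continuous_minus (fun t => 2 * ellDelta p t) (fun t => c * (1 / ellDelta p t))).
  - apply (continuous_scal_r 2 (ellDelta p)), continuous_ellDelta; auto.
  - apply (continuous_scal_r c (fun t => 1 / ellDelta p t)), continuous_inv_ellDelta; auto.
Qed.

Lemma modulus_gap_EK (c p : R) :
  0 <= p < 1 -> modulus_gap c p = 2 * ellE p - c * ellK p.
Proof.
  intros Hp; rewrite ellE_ellEinc, ellK_ellF by auto.
  assert (H : forall x, RInt (fun t => 2 * ellDelta p t - c * (1 / ellDelta p t)) 0 x
                        = 2 * ellEinc x p - c * ellF x p).
  { apply equal_of_derive with (a := 0)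
      (d := fun t => 2 * ellDelta p t - c * (1 / ellDelta p t)).
    - unfold ellEinc, ellF; rewrite !RInt_point; unfold zero; simpl; ring.
    - intros x; apply (is_derive_primitive
        (fun t => 2 * ellDelta p t - c * (1 / ellDelta p t))).
      intros u; apply continuous_gap_integrand; auto.
    - intros x; apply (is_derive_minus (fun y => 2 * ellEinc y p)
                         (fun y => c * ellF y p)).
      + apply (is_derive_scal (fun y => ellEinc y p)), is_derive_ellEinc; auto.
      + apply (is_derive_scal (fun y => ellF y p)), is_derive_ellF; auto. }
  apply H.
Qed.

Lemma ellDelta_decreasing (p q t : R) :
  0 <= p -> p < q -> q < 1 -> 0 < sin t -> ellDelta q t < ellDelta p t.
Proof.
  intros Hp Hpq Hq Ht; apply sqrt_lt_1_alt; split.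
  - left; apply ellDelta_arg_pos; lra.
  - assert (0 < sin t ^ 2) by (apply pow_lt; auto).
    assert (p ^ 2 < q ^ 2) by nra; nra.
Qed.

Lemma modulus_gap_decreasing (c p q : R) :
  0 <= c -> 0 <= p -> p < q -> q < 1 -> modulus_gap c q < modulus_gap c p.
Proof.
  intros Hc Hp Hpq Hq; assert (HPI := PI_RGT_0).
  apply RInt_lt; [lra | | |].
  - intros t _; apply continuous_gap_integrand; lra.
  - intros t _; apply continuous_gap_integrand; lra.
  - intros t Ht.
    assert (Hs : 0 < sin t) by (apply sin_gt_0; lra).
    assert (H := ellDelta_decreasing p q t Hp Hpq Hq Hs).
    assert (Hd := ellDelta_pos q t ltac:(lra)).
    assert (1 / ellDelta p t <= 1 / ellDelta q t).
    { unfold Rdiv; rewrite !Rmult_1_l; apply Rinv_le_contravar; lra. }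
    nra.
Qed.

Lemma ellDelta_modulus_lipschitz (p q r t : R) :
  0 <= p <= r -> 0 <= q <= r -> r < 1 ->
  Rabs (ellDelta p t - ellDelta q t) <= / (1 - r) * Rabs (p - q) /\
  1 - r <= ellDelta p t /\ 1 - r <= ellDelta q t.
Proof.
  intros Hp Hq Hr.
  assert (Hlb : forall s, 0 <= s <= r -> 1 - r <= ellDelta s t).
  { intros s Hs; unfold ellDelta; rewrite <- (sqrt_pow2 (1 - r)) by lra.
    apply sqrt_le_1_alt; assert (H := ellDelta_sqr_lb s t (proj1 Hs)); nra. }
  assert (Lp := Hlb p Hp); assert (Lq := Hlb q Hq); repeat split; auto.
  assert (Ep := ellDelta_sqr p t ltac:(lra)); assert (Eq := ellDelta_sqr q t ltac:(lra)).
  assert (Hs := sin_sqr_le t).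
  assert (Hsum : 0 < ellDelta p t + ellDelta q t) by lra.
  assert (E : ellDelta p t - ellDelta q t =
              - ((p + q) * sin t ^ 2 / (ellDelta p t + ellDelta q t)) * (p - q)).
  { apply Rmult_eq_reg_r with (ellDelta p t + ellDelta q t); [|lra].
    replace (- ((p + q) * sin t ^ 2 / (ellDelta p t + ellDelta q t)) * (p - q)
             * (ellDelta p t + ellDelta q t))
      with (- (p + q) * (p - q) * sin t ^ 2) by (field; lra).
    nra. }
  rewrite E, Rabs_mult, Rabs_Ropp; apply Rmult_le_compat_r; [apply Rabs_pos|].
  assert (0 <= (p + q) * sin t ^ 2) by (apply Rmult_le_pos; lra).
  rewrite Rabs_pos_eq by (apply Rmult_le_pos; [lra | left; apply Rinv_0_lt_compat; lra]).
  apply Rmult_le_reg_r with (ellDelta p t + ellDelta q t); [lra|].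
  unfold Rdiv; rewrite Rmult_assoc, Rinv_l, Rmult_1_r by lra.
  apply Rle_trans with 2; [nra|].
  apply Rmult_le_reg_l with (1 - r); [lra|].
  rewrite <- Rmult_assoc, Rinv_r by lra; lra.
Qed.

(** Away from modulus 1 the integrand is Lipschitz in the modulus, uniformly in
    the angle; this gives the continuity needed for the intermediate value
    theorem. *)
Lemma modulus_gap_lipschitz (c r : R) :
  0 <= c -> 0 <= r < 1 -> exists M, 0 < M /\
    forall p q, 0 <= p <= r -> 0 <= q <= r ->
      Rabs (modulus_gap c p - modulus_gap c q) <= M * Rabs (p - q).
Proof.
  intros Hc Hr; assert (HPI := PI_RGT_0).
  set (e := / (1 - r)); assert (He : 0 < e) by (apply Rinv_0_lt_compat; lra).
  exists (PI / 2 * ((2 + c * (e * e)) * e)); split.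
  { apply Rmult_lt_0_compat; [lra|]; apply Rmult_lt_0_compat; auto.
    assert (0 <= c * (e * e)) by (apply Rmult_le_pos; auto; nra); lra. }
  intros p q Hp Hq; unfold modulus_gap.
  assert (Xp : forall s, 0 <= s <= r -> ex_RInt
    (fun t => 2 * ellDelta s t - c * (1 / ellDelta s t)) 0 (PI / 2)).
  { intros s Hs; apply (@ex_RInt_continuous R_CompleteNormedModule); intros t _.
    apply continuous_gap_integrand; lra. }
  assert (E := RInt_minus _ _ 0 (PI / 2) (Xp p Hp) (Xp q Hq)).
  unfold minus, plus, opp in E; simpl in E; unfold Rminus at 1; rewrite <- E.
  replace (PI / 2 * ((2 + c * (e * e)) * e) * Rabs (p - q))
    with ((PI / 2 - 0) * ((2 + c * (e * e)) * (e * Rabs (p - q)))) by ring.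
  apply abs_RInt_le_const; [lra | |].
  - apply (@ex_RInt_minus R_CompleteNormedModule); apply Xp; auto.
  - intros t _.
    destruct (ellDelta_modulus_lipschitz p q r t Hp Hq (proj2 Hr)) as [HL [Lp Lq]].
    fold e in HL.
    replace (2 * ellDelta p t - c * (1 / ellDelta p t)
             + - (2 * ellDelta q t - c * (1 / ellDelta q t)))
      with ((2 + c * (/ ellDelta p t * / ellDelta q t)) * (ellDelta p t - ellDelta q t))
      by (field; lra).
    assert (Ip : 0 < / ellDelta p t <= e).
    { split; [apply Rinv_0_lt_compat; lra | apply Rinv_le_contravar; lra]. }
    assert (Iq : 0 < / ellDelta q t <= e).
    { split; [apply Rinv_0_lt_compat; lra | apply Rinv_le_contravar; lra]. }
    assert (Hm : 0 <= / ellDelta p t * / ellDelta q t <= e * e).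
    { split; [nra|]; apply Rmult_le_compat; lra. }
    assert (Hcm : 0 <= c * (/ ellDelta p t * / ellDelta q t) <= c * (e * e)).
    { split; [apply Rmult_le_pos; lra | apply Rmult_le_compat_l; lra]. }
    rewrite Rabs_mult, (Rabs_pos_eq (2 + _)) by lra.
    apply Rmult_le_compat; try lra; apply Rabs_pos.
Qed.

Lemma modulus_gap_0 (c : R) : modulus_gap c 0 = (2 - c) * (PI / 2).
Proof.
  unfold modulus_gap.
  rewrite RInt_ext with (g := fun _ => 2 - c).
  - rewrite RInt_const; unfold scal; simpl; unfold mult; simpl; ring.
  - intros t _; unfold ellDelta.
    replace (1 - 0 ^ 2 * sin t ^ 2) with 1 by ring; rewrite sqrt_1.
    apply Rminus_diag_uniq; field.
Qed.

(** Near the endpoint [pi / 2] the integrand of [K] is at least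
    [1 / (e + (pi / 2 - t))], [e] being the complementary modulus; hence [K] is
    at least [ln (1 + pi / (2 e))]. *)
Lemma ellK_log_lb (p e : R) :
  0 <= p < 1 -> 0 < e -> p ^ 2 + e ^ 2 = 1 ->
  ln (e + PI / 2) - ln e <= ellK p.
Proof.
  intros Hp He Hpe; rewrite ellK_ellF by auto; assert (HPI := PI_RGT_0).
  set (h := fun t => - ln (e + (PI / 2 - t))).
  set (h' := fun t => 1 / (e + (PI / 2 - t))).
  assert (Hh : forall t, 0 <= t <= PI / 2 -> is_derive h t (h' t)).
  { intros t Ht; unfold h, h'; auto_derive; [lra | field; lra]. }
  assert (Hc : forall t, 0 <= t <= PI / 2 -> continuous h' t).
  { intros t Ht; apply (ex_derive_continuous h'); unfold h'; auto_derive; lra. }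
  assert (I : is_RInt h' 0 (PI / 2) (h (PI / 2) - h 0)).
  { apply (is_RInt_derive h h'); rewrite Rmin_left, Rmax_right by lra; auto. }
  replace (ln (e + PI / 2) - ln e) with (RInt h' 0 (PI / 2)).
  - apply RInt_le; [lra | eexists; exact I | |].
    + apply (@ex_RInt_continuous R_CompleteNormedModule); intros t _.
      apply continuous_inv_ellDelta; auto.
    + intros t Ht; change (h' t <= 1 / ellDelta p t).
      replace (h' t) with (/ (e + (PI / 2 - t))) by (unfold h', Rdiv; ring).
      replace (1 / ellDelta p t) with (/ ellDelta p t) by (unfold Rdiv; ring).
      apply Rinv_le_contravar; [apply ellDelta_pos; auto|].
      assert (Hcos : 0 <= cos t <= PI / 2 - t).
      { split; [apply cos_ge_0; lra|].
        rewrite <- sin_shift; left; apply sin_lt_x; lra. }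
      unfold ellDelta; rewrite <- (sqrt_pow2 (e + (PI / 2 - t))) by lra.
      apply sqrt_le_1_alt.
      assert (Hsc := sin2_cos2 t); unfold Rsqr in Hsc.
      assert (cos t ^ 2 <= (PI / 2 - t) ^ 2) by (apply pow_incr; lra).
      assert (p ^ 2 <= 1) by nra; assert (0 <= cos t ^ 2) by apply pow2_ge_0.
      replace (sin t ^ 2) with (1 - cos t ^ 2) by lra.
      nra.
  - rewrite (is_RInt_unique _ _ _ _ I); unfold h.
    replace (e + (PI / 2 - PI / 2)) with e by ring.
    replace (e + (PI / 2 - 0)) with (e + PI / 2) by ring.
    apply Rminus_diag_uniq; ring.
Qed.

Lemma modulus_gap_nonpos (c : R) :
  1 <= c -> exists r, 0 < r < 1 /\ modulus_gap c r <= 0.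
Proof.
  intros Hc; assert (HPI := PI_RGT_0); assert (H4 := PI_4).
  assert (Hexp : 1 + PI < exp PI) by (apply exp_ineq1; lra).
  (* the complementary modulus for which the logarithmic bound exceeds pi *)
  set (e := PI / 2 / exp PI).
  assert (He : 0 < e < 1).
  { unfold e; split; [apply Rdiv_lt_0_compat; lra|].
    apply Rmult_lt_reg_r with (exp PI); [lra|].
    unfold Rdiv; rewrite Rmult_assoc, Rinv_l; lra. }
  set (r := sqrt (1 - e ^ 2)).
  assert (He2 : 0 < 1 - e ^ 2) by nra.
  assert (Er : r ^ 2 = 1 - e ^ 2) by (apply pow2_sqrt; lra).
  assert (Hr0 : 0 < r) by (apply sqrt_lt_R0; auto).
  assert (Hr : 0 < r < 1) by (split; [auto|]; nra).
  exists r; split; auto.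
  assert (HK := ellK_log_lb r e ltac:(lra) (proj1 He) ltac:(lra)).
  assert (Hln : PI < ln (e + PI / 2) - ln e).
  { rewrite <- ln_div by lra.
    rewrite <- (ln_exp PI) at 1; apply ln_increasing; [lra|].
    unfold e; apply Rlt_le_trans with (1 + exp PI); [lra|].
    right; field; split; [apply Rgt_not_eq; lra | lra]. }
  assert (HE : ellE r <= PI / 2).
  { rewrite ellE_ellEinc by lra.
    replace (PI / 2) with (RInt (fun _ => 1) 0 (PI / 2)) at 2.
    - apply RInt_le; [lra | | |].
      + apply (@ex_RInt_continuous R_CompleteNormedModule); intros t _.
        apply continuous_ellDelta; lra.
      + apply (@ex_RInt_const R_NormedModule).
      + intros t _; apply ellDelta_le_1; lra.
    - rewrite RInt_const; unfold scal; simpl; unfold mult; simpl; ring. }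
  rewrite modulus_gap_EK by lra; nra.
Qed.

Lemma modulus_exists (c : R) :
  1 < c < 2 -> exists p, 0 < p < 1 /\ modulus_gap c p = 0.
Proof.
  intros Hc; destruct (modulus_gap_nonpos c ltac:(lra)) as [r [Hr Hneg]].
  destruct (modulus_gap_lipschitz c r ltac:(lra) ltac:(lra)) as [M [HM HL]].
  assert (Hpos : 0 < modulus_gap c 0).
  { rewrite modulus_gap_0; assert (HPI := PI_RGT_0).
    apply Rmult_lt_0_compat; lra. }
  (* the modulus runs over [0, r] as r t, t in [0,1] *)
  assert (Hrange : forall t, I01 t -> 0 <= r * t <= r) by (unfold I01; intros; nra).
  assert (Hcont : continuous01 (fun t => modulus_gap c (r * t))).
  { intros t; apply continuous_eps; intros eps Heps.
    exists (eps / M); split; [apply Rdiv_lt_0_compat; auto|].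
    intros y Hy.
    eapply Rle_lt_trans; [apply HL; apply Hrange, clamp_I01|].
    rewrite <- Rmult_minus_distr_l, Rabs_mult, (Rabs_pos_eq r) by lra.
    assert (Hcl := clamp_contraction t y).
    apply Rmult_lt_reg_l with (/ M); [apply Rinv_0_lt_compat; auto|].
    rewrite <- Rmult_assoc, Rinv_l by lra.
    replace (/ M * eps) with (eps / M) by (unfold Rdiv; ring).
    assert (H0 := Rabs_pos (clamp y - clamp t)); nra. }
  destruct (ivt01 _ 0 1 0 ltac:(unfold I01; lra) ltac:(unfold I01; lra)
              ltac:(lra) Hcont) as [t [Ht E]].
  - right; rewrite Rmult_0_r, Rmult_1_r; lra.
  - exists (r * t); split; auto.
    destruct (Req_dec t 0) as [->|Hne].
    + rewrite Rmult_0_r in E; lra.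
    + nra.
Qed.

Lemma hat_p_spec (l L : R) :
  0 < l < L ->
  0 < hat_p l L < 1 /\ 2 * ellE (hat_p l L) / ellK (hat_p l L) - 1 = l / L.
Proof.
  intros Hl; set (c := 1 + l / L).
  assert (Hq : 0 < l / L < 1).
  { split; [apply Rdiv_lt_0_compat; lra|].
    apply Rmult_lt_reg_r with L; [lra|].
    unfold Rdiv; rewrite Rmult_assoc, Rinv_l; lra. }
  assert (Hgap : forall p, 0 < p < 1 ->
            (2 * ellE p / ellK p - 1 = l / L <-> modulus_gap c p = 0)).
  { intros p Hp; rewrite modulus_gap_EK by lra.
    assert (HK := ellK_pos p ltac:(lra)); unfold c; split; intros H.
    - replace (l / L) with (2 * ellE p / ellK p - 1); field; lra.
    - apply Rmult_eq_reg_r with (ellK p); [|lra].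
      replace ((2 * ellE p / ellK p - 1) * ellK p)
        with (2 * ellE p - ellK p) by (field; lra).
      lra. }
  destruct (modulus_exists c ltac:(unfold c; lra)) as [p [Hp E]].
  apply (iota_correct (fun p : R => 0 < p < 1 /\ 2 * ellE p / ellK p - 1 = l / L)).
  exists p; split.
  - split; [exact Hp | apply Hgap; auto].
  - intros q [Hq1 Eq]; apply Hgap in Eq; auto.
    destruct (Rtotal_order p q) as [H|[H|H]]; auto.
    + assert (H1 := modulus_gap_decreasing c p q ltac:(unfold c; lra)
                      ltac:(lra) H ltac:(lra)); lra.
    + assert (H1 := modulus_gap_decreasing c q p ltac:(unfold c; lra)
                      ltac:(lra) H ltac:(lra)); lra.
Qed.

(** * The moving frame of an admissible curve *)

Definition tangent_x (g : curve) (t : R) : R := Derive01 (cx g) t / speed g t.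
Definition tangent_y (g : curve) (t : R) : R := Derive01 (cy g) t / speed g t.

Lemma speed_sqr (g : curve) (t : R) :
  speed g t * speed g t
  = Derive01 (cx g) t * Derive01 (cx g) t + Derive01 (cy g) t * Derive01 (cy g) t.
Proof.
  unfold speed, velocity; simpl fst; simpl snd; rewrite sqrt_sqrt; nra.
Qed.

Lemma speed_pos (l L : R) (g : curve) (t : R) :
  admissible l L g -> I01 t -> 0 < speed g t.
Proof.
  intros (_ & _ & _ & _ & Hreg & _) Ht; specialize (Hreg t Ht).
  unfold velocity in Hreg.
  assert (Hs := speed_sqr g t).
  assert (Hp : 0 <= speed g t) by apply sqrt_pos.
  destruct Hp as [|H0]; auto; exfalso; apply Hreg.
  rewrite <- H0 in Hs; f_equal; nra.
Qed.

Lemma smooth01_speed (l L : R) (g : curve) :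
  admissible l L g -> smooth01 (speed g).
Proof.
  intros H; assert (Hp := fun t => speed_pos l L g t H).
  destruct H as (Hx & Hy & _).
  apply smooth01_Derive01 in Hx; apply smooth01_Derive01 in Hy.
  apply smooth01_ext with (f := fun t => sqrt
    (Derive01 (cx g) t * Derive01 (cx g) t + Derive01 (cy g) t * Derive01 (cy g) t)).
  - intros t _; rewrite <- speed_sqr; apply sqrt_square, sqrt_pos.
  - apply smooth01_sqrt.
    + intros t Ht; rewrite <- speed_sqr; apply Rmult_lt_0_compat; auto.
    + apply smooth01_plus; apply smooth01_mult; auto.
Qed.

Lemma smooth01_curvature (l L : R) (g : curve) :
  admissible l L g -> smooth01 (curvature g).
Proof.
  intros H; assert (Hp := fun t => speed_pos l L g t H).
  assert (Hv := smooth01_speed l L g H).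
  destruct H as (Hx & Hy & _).
  apply smooth01_Derive01 in Hx; apply smooth01_Derive01 in Hy.
  assert (Hx2 := smooth01_Derive01 _ Hx); assert (Hy2 := smooth01_Derive01 _ Hy).
  apply smooth01_ext with (f := fun t =>
    (Derive01 (cx g) t * Derive01 (Derive01 (cy g)) t
     + - (Derive01 (cy g) t * Derive01 (Derive01 (cx g)) t))
    * / (speed g t * (speed g t * speed g t))).
  - intros t Ht; unfold curvature, velocity, acceleration; simpl.
    assert (H0 := Hp t Ht); field; lra.
  - apply smooth01_mult.
    + apply smooth01_plus; [|apply smooth01_opp]; apply smooth01_mult; auto.
    + apply smooth01_inv; [|repeat apply smooth01_mult; auto].
      intros t Ht; assert (H0 := Hp t Ht).
      apply Rgt_not_eq; repeat apply Rmult_lt_0_compat; auto.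
Qed.

Lemma is_derive01_arclength (l L : R) (g : curve) (t : R) :
  admissible l L g -> I01 t -> is_derive01 (arclength g) t (speed g t).
Proof.
  intros H Ht; apply is_derive01_RInt; auto.
  apply smooth01_continuous, (smooth01_speed l L); auto.
Qed.

Lemma is_derive01_cx (l L : R) (g : curve) (t : R) :
  admissible l L g -> I01 t ->
  is_derive01 (cx g) t (tangent_x g t * speed g t).
Proof.
  intros H Ht; assert (Hp := speed_pos l L g t H Ht).
  apply is_derive01_value with (d := Derive01 (cx g) t).
  - apply smooth01_is_derive01; auto; apply H.
  - unfold tangent_x; field; lra.
Qed.

Lemma is_derive01_cy (l L : R) (g : curve) (t : R) :
  admissible l L g -> I01 t ->
  is_derive01 (cy g) t (tangent_y g t * speed g t).
Proof.
  intros H Ht; assert (Hp := speed_pos l L g t H Ht).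
  apply is_derive01_value with (d := Derive01 (cy g) t).
  - apply smooth01_is_derive01; auto; apply H.
  - unfold tangent_y; field; lra.
Qed.

Lemma tangent_unit (l L : R) (g : curve) (t : R) :
  admissible l L g -> I01 t -> tangent_x g t ^ 2 + tangent_y g t ^ 2 = 1.
Proof.
  intros H Ht; assert (Hp := speed_pos l L g t H Ht).
  assert (Hs := speed_sqr g t); unfold tangent_x, tangent_y.
  set (a := Derive01 (cx g) t) in *; set (b := Derive01 (cy g) t) in *.
  set (v := speed g t) in *.
  replace ((a / v) ^ 2 + (b / v) ^ 2) with ((a * a + b * b) / (v * v))
    by (field; lra).
  rewrite <- Hs; field; lra.
Qed.

Lemma is_derive01_speed (l L : R) (g : curve) (t : R) :
  admissible l L g -> I01 t ->
  is_derive01 (speed g) t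
    ((Derive01 (cx g) t * Derive01 (Derive01 (cx g)) t
      + Derive01 (cy g) t * Derive01 (Derive01 (cy g)) t) / speed g t).
Proof.
  intros H Ht; assert (Hp := speed_pos l L g t H Ht).
  destruct H as (Hx & Hy & _).
  apply smooth01_Derive01 in Hx; apply smooth01_Derive01 in Hy.
  assert (Dx := smooth01_is_derive01 _ t Hx Ht).
  assert (Dy := smooth01_is_derive01 _ t Hy Ht).
  assert (E : forall u, speed g u = sqrt
    (Derive01 (cx g) u * Derive01 (cx g) u + Derive01 (cy g) u * Derive01 (cy g) u)).
  { intros u; rewrite <- speed_sqr; symmetry; apply sqrt_square, sqrt_pos. }
  apply is_derive01_ext with (f := fun u => sqrt
    (Derive01 (cx g) u * Derive01 (cx g) u + Derive01 (cy g) u * Derive01 (cy g) u));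
    auto.
  eapply is_derive01_value.
  - apply is_derive01_sqrt; auto.
    + rewrite <- speed_sqr; apply Rmult_lt_0_compat; auto.
    + apply is_derive01_plus; auto; apply is_derive01_mult; eauto.
  - simpl; rewrite <- E; field; lra.
Qed.

(** The Frenet equations. *)
Lemma is_derive01_tangent (l L : R) (g : curve) (t : R) :
  admissible l L g -> I01 t ->
  is_derive01 (tangent_x g) t (- (tangent_y g t * (curvature g t * speed g t))) /\
  is_derive01 (tangent_y g) t (tangent_x g t * (curvature g t * speed g t)).
Proof.
  intros H Ht; assert (Hp := speed_pos l L g t H Ht).
  assert (Dv := is_derive01_speed l L g t H Ht).
  assert (Hs := speed_sqr g t).
  destruct H as (Hx & Hy & _).
  apply smooth01_Derive01 in Hx; apply smooth01_Derive01 in Hy.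
  assert (Dx := smooth01_is_derive01 _ t Hx Ht).
  assert (Dy := smooth01_is_derive01 _ t Hy Ht).
  assert (Di := is_derive01_inv _ t _ Ht (Rgt_not_eq _ _ Hp) Dv).
  split.
  - eapply is_derive01_value; [apply (is_derive01_mult _ _ t _ _ Ht Dx Di)|].
    unfold curvature, tangent_y, velocity, acceleration; simpl.
    set (a := Derive01 (cx g) t) in *; set (b := Derive01 (cy g) t) in *.
    set (v := speed g t) in *.
    set (a2 := Derive01 (Derive01 (cx g)) t); set (b2 := Derive01 (Derive01 (cy g)) t).
    apply Rminus_diag_uniq.
    match goal with |- ?X = 0 =>
      replace X with (a2 * (v * v - (a * a + b * b)) / (v * v * v)) by (field; lra) end.
    replace (v * v - (a * a + b * b)) with 0 by lra; field; lra.
  - eapply is_derive01_value; [apply (is_derive01_mult _ _ t _ _ Ht Dy Di)|].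
    unfold curvature, tangent_x, velocity, acceleration; simpl.
    set (a := Derive01 (cx g) t) in *; set (b := Derive01 (cy g) t) in *.
    set (v := speed g t) in *.
    set (a2 := Derive01 (Derive01 (cx g)) t); set (b2 := Derive01 (Derive01 (cy g)) t).
    apply Rminus_diag_uniq.
    match goal with |- ?X = 0 =>
      replace X with (b2 * (v * v - (a * a + b * b)) / (v * v * v)) by (field; lra) end.
    replace (v * v - (a * a + b * b)) with 0 by lra; field; lra.
Qed.

Lemma arclength_0 (g : curve) : arclength g 0 = 0.
Proof. unfold arclength; rewrite RInt_point; reflexivity. Qed.

Lemma arclength_1 (l L : R) (g : curve) : admissible l L g -> arclength g 1 = L.
Proof. intros (_ & _ & _ & _ & _ & H); exact H. Qed.

Lemma continuous01_arclength (l L : R) (g : curve) :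
  admissible l L g -> continuous01 (arclength g).
Proof.
  intros H; apply continuous01_of_derive; intros t Ht.
  eexists; apply (is_derive01_arclength l L); auto.
Qed.

Lemma arclength_increasing (l L : R) (g : curve) (t u : R) :
  admissible l L g -> I01 t -> I01 u -> t < u -> arclength g t < arclength g u.
Proof.
  intros H Ht Hu Htu; unfold I01 in *.
  apply increasing01 with (d := speed g); try lra.
  - apply (continuous01_arclength l L); auto.
  - intros v Hv; apply (is_derive01_arclength l L); auto; unfold I01; lra.
  - intros v Hv; apply (speed_pos l L); auto; unfold I01; lra.
Qed.

Lemma arclength_range (l L : R) (g : curve) (t : R) :
  admissible l L g -> I01 t -> 0 <= arclength g t <= L.
Proof.
  intros H Ht; rewrite <- (arclength_0 g) at 1; rewrite <- (arclength_1 l L g H).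
  assert (Hle : forall u v, I01 u -> I01 v -> u <= v ->
                arclength g u <= arclength g v).
  { intros u v Hu Hv [Huv|<-]; [left; apply (arclength_increasing l L)|right]; auto. }
  unfold I01 in *; split; apply Hle; lra.
Qed.

Lemma arclength_interior (l L : R) (g : curve) (t : R) :
  admissible l L g -> 0 < t < 1 -> 0 < arclength g t < L.
Proof.
  intros H Ht.
  assert (H0 := arclength_increasing l L g 0 t H).
  assert (H1 := arclength_increasing l L g t 1 H).
  rewrite arclength_0 in H0; rewrite (arclength_1 l L g H) in H1.
  unfold I01 in *; split; [apply H0 | apply H1]; lra.
Qed.

Lemma arclength_inj (l L : R) (g : curve) (t u : R) :
  admissible l L g -> I01 t -> I01 u -> arclength g t = arclength g u -> t = u.
Proof.
  intros H Ht Hu E; destruct (Rtotal_order t u) as [H1|[H1|H1]]; auto.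
  - assert (H2 := arclength_increasing l L g t u H Ht Hu H1); lra.
  - assert (H2 := arclength_increasing l L g u t H Hu Ht H1); lra.
Qed.

Lemma arclength_surj (l L : R) (g : curve) (s : R) :
  admissible l L g -> 0 <= s <= L -> exists t, I01 t /\ arclength g t = s.
Proof.
  intros H Hs.
  destruct (ivt01 (arclength g) 0 1 s) as [t [Ht E]]; try (unfold I01; lra).
  - apply (continuous01_arclength l L); auto.
  - left; rewrite arclength_0, (arclength_1 l L g H); lra.
  - exists t; split; auto.
Qed.

Lemma arclength_reparam_arclength (l L : R) (g : curve) (t : R) :
  admissible l L g -> I01 t -> arclength_reparam g (arclength g t) = g t.
Proof.
  intros H Ht; unfold arclength_reparam; f_equal.
  apply (iota_unique (fun u : R => I01 u /\ arclength g u = arclength g t)); auto.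
  intros u [Hu E]; apply (arclength_inj l L g); auto.
Qed.

Lemma equal_on_arclength (l L : R) (g h : curve) :
  admissible l L g ->
  (equal_on L (arclength_reparam g) h <->
   forall t, I01 t -> g t = h (arclength g t)).
Proof.
  intros H; split.
  - intros E t Ht; rewrite <- E by (apply (arclength_range l L); auto).
    symmetry; apply (arclength_reparam_arclength l L); auto.
  - intros E s Hs; destruct (arclength_surj l L g s H Hs) as [t [Ht <-]].
    rewrite (arclength_reparam_arclength l L) by auto; auto.
Qed.

(** * Half waves and their minimality *)

Set Implicit Arguments.

(** An arc length parametrized solution [(X, Y)] of the pendulum equation
    [theta'' = - lam sin theta] on [0,L], over half a period: the tangent angle
    has cosine [C], sine [S] and derivative (the curvature) [K]; it vanishes at
    [L / 2], and [K] vanishes at the ends and only there. *)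
Record half_wave (l L lam : R) (X Y C S K : R -> R) : Prop := {
  hw_lam : 0 < lam;
  hw_X : forall s, is_derive X s (C s);
  hw_Y : forall s, is_derive Y s (S s);
  hw_C : forall s, is_derive C s (- (S s * K s));
  hw_S : forall s, is_derive S s (C s * K s);
  hw_K : forall s, is_derive K s (- (lam * S s));
  hw_unit : forall s, C s ^ 2 + S s ^ 2 = 1;
  hw_X_0 : X 0 = 0;
  hw_Y_0 : Y 0 = 0;
  hw_X_L : X L = l;
  hw_C_mid : C (L / 2) = 1;
  hw_K_0 : K 0 = 0;
  hw_K_neg : forall s, 0 < s < L -> K s < 0;
  hw_S_pos : forall s, 0 <= s < L / 2 -> 0 < S s;
  hw_C_sym : forall s, C (L - s) = C s;
  hw_S_sym : forall s, S (L - s) = - S s;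
  hw_K_sym : forall s, K (L - s) = K s
}.

Unset Implicit Arguments.

Arguments hw_K_neg {l L lam X Y C S K} _ s _.
Arguments hw_S_pos {l L lam X Y C S K} _ s _.

Section Minimality.

Context (l L lam : R) (X Y C S K : R -> R).
Context (hl : 0 < l) (hL : 0 < L) (W : half_wave l L lam X Y C S K).

Lemma hw_S_mid : S (L / 2) = 0.
Proof.
  assert (H := hw_unit W (L / 2)).
  rewrite (hw_C_mid W) in H; nra.
Qed.

Lemma hw_S_ne (s : R) : 0 <= s <= L -> s <> L / 2 -> S s <> 0.
Proof.
  intros Hs Hne; destruct (Rlt_dec s (L / 2)) as [H|H].
  - apply Rgt_not_eq, (hw_S_pos W); lra.
  - assert (H1 := hw_S_pos W (L - s) ltac:(lra)).
    rewrite (hw_S_sym W) in H1; lra.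
Qed.

Lemma hw_K_L : K L = 0.
Proof.
  rewrite <- (hw_K_0 W), <- (hw_K_sym W 0).
  f_equal; ring.
Qed.

Lemma hw_K_continuous (s : R) : continuous (fun s => K s ^ 2) s.
Proof.
  apply (ex_derive_continuous (fun s => K s ^ 2)); eexists.
  apply (is_derive_pow K 2), (hw_K W).
Qed.

Definition wave_energy (s : R) : R := RInt (fun r => K r ^ 2) 0 s.

Lemma is_derive_wave_energy (s : R) : is_derive wave_energy s (K s ^ 2).
Proof. exact (is_derive_primitive (fun r => K r ^ 2) s hw_K_continuous). Qed.

Section Competitor.

Context (g : curve) (Hg : admissible l L g).

Let s := arclength g.
Let v := speed g.
Let k := curvature g.
Let u := tangent_x g.
Let w := tangent_y g.

Lemma is_derive01_along (F : R -> R) (t d : R) :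
  I01 t -> is_derive F (s t) d -> is_derive01 (fun r => F (s r)) t (d * v t).
Proof.
  intros Ht HF; apply is_derive01_value with (d := v t * d); [|ring].
  apply is_derive01_comp; auto; apply (is_derive01_arclength l L); auto.
Qed.

Lemma continuous01_along (F : R -> R) :
  (forall r, exists d, is_derive F r d) -> continuous01 (fun t => F (s t)).
Proof.
  intros HF; apply continuous01_of_derive; intros t Ht.
  destruct (HF (s t)) as [d Hd]; eexists; apply is_derive01_along; eauto.
Qed.

(** Comparing the Frenet equations of [g] with those of the wave gives the
    curvature [e K] at equal arc length; the energy is then an integral over arc
    length that does not depend on [g]. *)
Lemma energy_of_half_wave (e : R) :
  e ^ 2 = 1 ->
  (forall t, I01 t -> cx g t = X (s t)) ->
  (forall t, I01 t -> cy g t = e * Y (s t)) ->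
  (forall t, I01 t -> k t = e * K (s t)) /\
  elastic_energy g = wave_energy L.
Proof.
  intros He Hx Hy.
  assert (Hu : forall t, I01 t -> C (s t) = u t).
  { intros t Ht; assert (Hv := speed_pos l L g t Hg Ht).
    apply Rmult_eq_reg_r with (v t); [|unfold v; lra].
    apply (is_derive01_unique (cx g) t); auto.
    - apply is_derive01_ext with (f := fun r => X (s r)); auto.
      + intros r Hr; symmetry; auto.
      + apply is_derive01_along; auto; apply (hw_X W).
    - apply (is_derive01_cx l L); auto. }
  assert (Hw : forall t, I01 t -> e * S (s t) = w t).
  { intros t Ht; assert (Hv := speed_pos l L g t Hg Ht).
    apply Rmult_eq_reg_r with (v t); [|unfold v; lra].
    apply (is_derive01_unique (cy g) t); auto.
    - apply is_derive01_ext with (f := fun r => e * Y (s r)); auto.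
      + intros r Hr; symmetry; auto.
      + rewrite Rmult_assoc; apply is_derive01_scal; auto.
        apply is_derive01_along; auto; apply (hw_Y W).
    - apply (is_derive01_cy l L); auto. }
  assert (Hk : forall t, I01 t -> k t = e * K (s t)).
  { intros t Ht; assert (Hv := speed_pos l L g t Hg Ht); fold v in Hv.
    destruct (is_derive01_tangent l L g t Hg Ht) as [Du Dw].
    assert (E1 : - (S (s t) * K (s t)) * v t = - (w t * (k t * v t))).
    { apply (is_derive01_unique u t); auto.
      apply is_derive01_ext with (f := fun r => C (s r)); auto.
      apply is_derive01_along; auto; apply (hw_C W). }
    assert (E2 : e * (C (s t) * K (s t) * v t) = u t * (k t * v t)).
    { apply (is_derive01_unique w t); auto.
      apply is_derive01_ext with (f := fun r => e * S (s r)); auto.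
      apply is_derive01_scal; auto.
      apply is_derive01_along; auto; apply (hw_S W). }
    rewrite <- Hw in E1 by auto; rewrite <- Hu in E2 by auto.
    assert (Hn := hw_unit W (s t)).
    apply Rmult_eq_reg_r with (v t); [|lra].
    apply Rminus_diag_uniq.
    replace (k t * v t - e * K (s t) * v t) with
      (k t * v t * (C (s t) ^ 2 + e ^ 2 * S (s t) ^ 2)
       - e * K (s t) * v t * (C (s t) ^ 2 + S (s t) ^ 2))
      by (rewrite He, Rmult_1_l, Hn; ring).
    replace (k t * v t * (C (s t) ^ 2 + e ^ 2 * S (s t) ^ 2)) with
      (C (s t) * (C (s t) * (k t * v t)) + e * S (s t) * (e * S (s t) * (k t * v t)))
      by ring.
    rewrite <- E2.
    replace (e * S (s t) * (k t * v t)) with (S (s t) * K (s t) * v t) by lra.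
    ring. }
  split; auto.
  unfold elastic_energy; fold k v.
  rewrite (RInt01_derive (fun t => wave_energy (s t))); unfold I01; try lra.
  - unfold s; rewrite arclength_0, (arclength_1 l L g Hg).
    unfold wave_energy at 2; rewrite RInt_point; unfold zero; simpl; ring.
  - apply continuous01_mult.
    + apply (continuous01_mult k (fun t => k t * 1)); [|apply continuous01_mult];
        try apply smooth01_continuous, (smooth01_curvature l L g Hg).
      intros t; apply continuous_const.
    + apply smooth01_continuous, (smooth01_speed l L g Hg).
  - intros t Ht; rewrite Hk by auto.
    replace ((e * K (s t)) ^ 2) with (K (s t) ^ 2) by (rewrite Rpow_mult_distr, He; ring).
    apply is_derive01_along; auto; apply is_derive_wave_energy.
Qed.

(** Every competitor is compared with the half wave in the frame of its own
    midpoint (in arc length), reached at parameter [t0]. *)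
Context (t0 : R) (It0 : I01 t0) (Ht0 : s t0 = L / 2).

Let u0 := u t0.
Let w0 := w t0.

(** Cosine and sine of the angle between the tangents at [t] and [t0]. *)
Let c (t : R) := u t * u0 + w t * w0.
Let sg (t : R) := w t * u0 - u t * w0.

Let quot (t : R) := (c t - C (s t)) / S (s t).

(** The competitor's energy minus that of the half wave, with the Lagrange
    multiplier term, on [0,t]; as [int c v] is the displacement in the direction
    of the tangent at [t0], this needs no further integral. *)
Let excess (t : R) :=
  RInt (fun r => k r ^ 2 * v r) 0 t - wave_energy (s t)
  + 2 * lam * (cx g t * u0 + cy g t * w0 - X (s t)).

Let defect (t : R) := excess t + 2 * K (s t) * quot t.

Lemma competitor_c_t0 : c t0 = 1.
Proof.
  assert (H := tangent_unit l L g t0 Hg It0).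
  unfold c, u0, w0, u, w; lra.
Qed.

Lemma competitor_unit (t : R) : I01 t -> c t ^ 2 + sg t ^ 2 = 1.
Proof.
  intros Ht; assert (H := tangent_unit l L g t Hg Ht).
  assert (H0 := tangent_unit l L g t0 Hg It0).
  unfold c, sg, u0, w0, u, w.
  replace (_ + _) with ((tangent_x g t ^ 2 + tangent_y g t ^ 2)
                        * (tangent_x g t0 ^ 2 + tangent_y g t0 ^ 2)) by ring.
  rewrite H, H0; ring.
Qed.

Lemma is_derive01_c (t : R) : I01 t -> is_derive01 c t (- (sg t * k t) * v t).
Proof.
  intros Ht; destruct (is_derive01_tangent l L g t Hg Ht) as [Du Dw].
  eapply is_derive01_value.
  - apply is_derive01_plus; auto; apply is_derive01_mult; auto;
      first [exact Du | exact Dw | apply is_derive01_const; auto].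
  - unfold sg, u, w, k, v; ring.
Qed.

Lemma is_derive01_c_minus (t : R) :
  I01 t -> is_derive01 (fun r => c r - C (s r)) t
             ((- (sg t * k t) + S (s t) * K (s t)) * v t).
Proof.
  intros Ht; eapply is_derive01_value.
  - apply is_derive01_minus; auto; [apply is_derive01_c; auto|].
    apply is_derive01_along; auto; apply (hw_C W).
  - ring.
Qed.

Lemma is_derive01_S_along (t : R) :
  I01 t -> is_derive01 (fun r => S (s r)) t (C (s t) * K (s t) * v t).
Proof.
  intros Ht; apply is_derive01_along; auto; apply (hw_S W).
Qed.

Lemma S_along_ne (t : R) : I01 t -> t <> t0 -> S (s t) <> 0.
Proof.
  intros Ht Hne; apply hw_S_ne.
  - apply (arclength_range l L); auto.
  - rewrite <- Ht0; intros E; apply Hne, (arclength_inj l L g); auto.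
Qed.

(** At [t0] both [c] and [C] have value 1 and derivative 0, while [S] has a
    simple zero. *)
Lemma continuous01_quot : continuous01 quot.
Proof.
  apply (quotient_continuous01 (fun t => c t - C (s t)) (fun t => S (s t)) t0
           (C (s t0) * K (s t0) * v t0)); auto.
  - intros t Ht; eexists; apply is_derive01_c_minus; auto.
  - intros t Ht; eexists; apply is_derive01_S_along; auto.
  - apply S_along_ne.
  - rewrite competitor_c_t0, Ht0, (hw_C_mid W); ring.
  - rewrite Ht0; apply hw_S_mid.
  - eapply is_derive01_value; [apply is_derive01_c_minus; auto|].
    rewrite Ht0, hw_S_mid; unfold sg, u0, w0; ring.
  - apply is_derive01_S_along; auto.
  - rewrite Ht0, (hw_C_mid W), Rmult_1_l.
    assert (Hv := speed_pos l L g t0 Hg It0).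
    assert (HK := hw_K_neg W (L / 2) ltac:(lra)).
    apply Rmult_integral_contrapositive; unfold v; lra.
Qed.

Lemma is_derive01_excess (t : R) :
  I01 t -> is_derive01 excess t
    ((k t ^ 2 - K (s t) ^ 2 + 2 * lam * (c t - C (s t))) * v t).
Proof.
  intros Ht; eapply is_derive01_value.
  - apply is_derive01_plus; auto.
    + apply is_derive01_minus; auto.
      * apply is_derive01_RInt; auto.
        apply continuous01_mult.
        -- apply (continuous01_mult k (fun t => k t * 1));
             [|apply continuous01_mult];
             try apply smooth01_continuous, (smooth01_curvature l L g Hg).
           intros r; apply continuous_const.
        -- apply smooth01_continuous, (smooth01_speed l L g Hg).
      * apply is_derive01_along; auto; apply is_derive_wave_energy.
    + apply is_derive01_scal; auto.
      apply is_derive01_minus; auto.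
      * apply is_derive01_plus; auto; apply is_derive01_mult; auto;
          first [apply (is_derive01_cx l L); auto; fail
                |apply (is_derive01_cy l L); auto; fail
                |apply is_derive01_const; auto].
      * apply is_derive01_along; auto; apply (hw_X W).
  - unfold c, u, w, v; ring.
Qed.

(** The calibration identity. With [m = - K / S] one has
    [m' = lam + m^2 C], and completing squares leaves
    [(k + m sg)^2 + m^2 (c - C)^2]. *)
Lemma is_derive01_defect (t : R) :
  I01 t -> t <> t0 -> is_derive01 defect t
    (((k t - K (s t) / S (s t) * sg t) ^ 2
      + (K (s t) / S (s t) * (c t - C (s t))) ^ 2) * v t).
Proof.
  intros Ht Hne; assert (HS := S_along_ne t Ht Hne).
  assert (DK := is_derive01_along K t _ Ht (hw_K W (s t))).
  assert (DS := is_derive01_S_along t Ht).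
  assert (Dc := is_derive01_c_minus t Ht).
  eapply is_derive01_value.
  - apply is_derive01_plus; auto; [apply is_derive01_excess; auto|].
    apply is_derive01_mult; auto.
    + apply is_derive01_scal; eauto.
    + apply is_derive01_mult; eauto; apply is_derive01_inv; eauto.
  - simpl.
    assert (Hn := hw_unit W (s t)).
    assert (Hn2 := competitor_unit t Ht).
    unfold quot; set (cc := c t) in *; set (ss := sg t) in *.
    set (C' := C (s t)) in *; set (S' := S (s t)) in *; set (K' := K (s t)).
    set (kk := k t); set (vv := v t).
    apply Rminus_diag_uniq.
    (* what is left is a combination of c^2 + sg^2 = 1 and C^2 + S^2 = 1 *)
    match goal with |- ?A = 0 => replace A with
      (- (K' / S') ^ 2 * ((cc ^ 2 + ss ^ 2 - 1) - (C' ^ 2 + S' ^ 2 - 1)) * vv)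
      by (field; auto) end.
    rewrite Hn, Hn2; ring.
Qed.

Lemma continuous01_defect : continuous01 defect.
Proof.
  intros t.
  apply (continuous_plus (fun r => excess (clamp r))
           (fun r => 2 * K (s (clamp r)) * quot (clamp r))).
  - revert t; apply (continuous01_of_derive excess).
    intros t Ht; eexists; apply is_derive01_excess; auto.
  - revert t; apply (continuous01_mult (fun r => 2 * K (s r)) quot).
    + apply (continuous01_along (fun r => 2 * K r)).
      intros r; eexists; apply (is_derive_scal K), (hw_K W).
    + apply continuous01_quot.
Qed.

Lemma defect_0 : defect 0 = 0.
Proof.
  unfold defect, excess, s; rewrite arclength_0.
  rewrite (hw_K_0 W), (hw_X_0 W).
  unfold wave_energy; rewrite !RInt_point.
  destruct Hg as (_ & _ & H0 & _); unfold cx, cy; rewrite H0.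
  unfold zero; simpl; ring.
Qed.

(** The boundary term drops out as [K L = 0]; the displacement along the midpoint
    tangent is [l u0], since the end point is [(l, 0)]. *)
Lemma defect_1 :
  defect 1 = elastic_energy g - wave_energy L - 2 * lam * l * (1 - u0).
Proof.
  unfold defect, excess, s; rewrite (arclength_1 l L g Hg).
  rewrite hw_K_L, (hw_X_L W).
  destruct Hg as (_ & _ & _ & H1 & _); unfold cx, cy; rewrite H1.
  unfold elastic_energy, k, v; simpl; ring.
Qed.

Lemma t0_interior : 0 < t0 < 1.
Proof.
  unfold I01 in It0; split.
  - destruct (Req_dec t0 0) as [E|]; [|lra].
    assert (H := Ht0); unfold s in H; rewrite E, arclength_0 in H; lra.
  - destruct (Req_dec t0 1) as [E|]; [|lra].
    assert (H := Ht0); unfold s in H; rewrite E, (arclength_1 l L g Hg) in H; lra.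
Qed.

Lemma defect_derivative_nonneg (t : R) :
  I01 t ->
  0 <= ((k t - K (s t) / S (s t) * sg t) ^ 2
        + (K (s t) / S (s t) * (c t - C (s t))) ^ 2) * v t.
Proof.
  intros Ht; apply Rmult_le_pos.
  - apply Rplus_le_le_0_compat; apply pow2_ge_0.
  - left; apply (speed_pos l L); auto.
Qed.

Lemma defect_monotone : defect 0 <= defect t0 <= defect 1.
Proof.
  assert (H := t0_interior); split;
    apply nondecreasing01 with (d := fun t =>
      ((k t - K (s t) / S (s t) * sg t) ^ 2
       + (K (s t) / S (s t) * (c t - C (s t))) ^ 2) * v t);
    try lra; try apply continuous01_defect; intros t Ht;
    (apply is_derive01_defect || apply defect_derivative_nonneg);
    unfold I01; lra.
Qed.

Lemma competitor_u0_le_1 : u0 <= 1.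
Proof.
  assert (H := tangent_unit l L g t0 Hg It0); unfold u0, u; nra.
Qed.

Lemma energy_lower_bound : wave_energy L <= elastic_energy g.
Proof.
  assert (H := defect_monotone); rewrite defect_0, defect_1 in H.
  assert (Hu := competitor_u0_le_1).
  assert (Hlam := hw_lam W).
  assert (0 <= 2 * lam * l * (1 - u0)).
  { apply Rmult_le_pos; [|lra]; apply Rmult_le_pos; lra. }
  lra.
Qed.

(** Equality forces the midpoint tangent to be horizontal and all squares in
    the calibration identity to vanish, hence [c = C] and [k^2 = K^2]; as the
    curvature has no zero in between, it is [K] or [- K] throughout. *)
Lemma energy_equality :
  elastic_energy g = wave_energy L ->
  exists e, (e = 1 \/ e = -1) /\
    forall t, I01 t -> cx g t = X (s t) /\ cy g t = e * Y (s t).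
Proof.
  intros E; assert (Hm := defect_monotone); rewrite defect_0, defect_1 in Hm.
  assert (Hu := competitor_u0_le_1).
  assert (Hlam := hw_lam W).
  assert (Hll : 0 < 2 * lam * l) by (apply Rmult_lt_0_compat; lra).
  assert (Eu0 : u0 = 1) by nra.
  assert (Ew0 : w0 = 0).
  { assert (H := tangent_unit l L g t0 Hg It0); fold u w u0 w0 in H.
    fold u0 w0 in H; rewrite Eu0 in H; nra. }
  assert (Ht := t0_interior).
  assert (Hflat : forall t, 0 < t < 1 -> t <> t0 ->
    ((k t - K (s t) / S (s t) * sg t) ^ 2
     + (K (s t) / S (s t) * (c t - C (s t))) ^ 2) * v t = 0).
  { intros t It Hne; destruct (Rlt_dec t t0) as [Hlt|Hlt].
    - apply (nondecreasing01_rigid defect (fun t =>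
        ((k t - K (s t) / S (s t) * sg t) ^ 2
         + (K (s t) / S (s t) * (c t - C (s t))) ^ 2) * v t) 0 t0);
        try lra; try apply continuous01_defect.
      + intros r Hr; apply is_derive01_defect; unfold I01; lra.
      + intros r Hr; apply defect_derivative_nonneg; unfold I01; lra.
      + rewrite defect_0; rewrite Eu0, E in Hm; lra.
    - apply (nondecreasing01_rigid defect (fun t =>
        ((k t - K (s t) / S (s t) * sg t) ^ 2
         + (K (s t) / S (s t) * (c t - C (s t))) ^ 2) * v t) t0 1);
        try lra; try apply continuous01_defect.
      + intros r Hr; apply is_derive01_defect; unfold I01; lra.
      + intros r Hr; apply defect_derivative_nonneg; unfold I01; lra.
      + rewrite defect_1; rewrite Eu0, E in *; lra. }
  assert (Hck : forall t, 0 < t < 1 -> t <> t0 ->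
            c t - C (s t) = 0 /\ k t * k t - K (s t) * K (s t) = 0).
  { intros t It Hne; assert (I : I01 t) by (unfold I01; lra).
    assert (Hv := speed_pos l L g t Hg I); fold v in Hv.
    assert (HS := S_along_ne t I Hne).
    assert (HK := hw_K_neg W (s t)
                    (arclength_interior l L g t Hg It)).
    assert (Hz := Hflat t It Hne).
    apply Rmult_integral in Hz; destruct Hz as [Hz|]; [|lra].
    set (m := K (s t) / S (s t)) in *.
    assert (Em : m <> 0).
    { apply Rmult_integral_contrapositive; split; [lra|].
      apply Rinv_neq_0_compat; auto. }
    assert (E1 : (k t - m * sg t) ^ 2 = 0).
    { assert (A1 := pow2_ge_0 (k t - m * sg t)).
      assert (A2 := pow2_ge_0 (m * (c t - C (s t)))); lra. }
    assert (E2 : (m * (c t - C (s t))) ^ 2 = 0).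
    { rewrite E1 in Hz; lra. }
    assert (E3 : c t - C (s t) = 0).
    { assert (E4 : m * (c t - C (s t)) = 0) by nra.
      apply Rmult_integral in E4; tauto. }
    split; auto.
    assert (E5 : k t = m * sg t) by nra.
    assert (Hn := hw_unit W (s t)).
    assert (Hn2 := competitor_unit t I).
    assert (E6 : c t = C (s t)) by lra; rewrite E6 in Hn2.
    assert (E7 : sg t * sg t = S (s t) * S (s t)) by lra.
    rewrite E5.
    replace (m * sg t * (m * sg t)) with (m * m * (sg t * sg t)) by ring.
    rewrite E7; unfold m; field; auto. }
  assert (Ck : continuous01 k).
  { apply smooth01_continuous, (smooth01_curvature l L g Hg). }
  assert (CK : continuous01 (fun t => K (s t))).
  { apply continuous01_along; intros r; eexists; apply (hw_K W). }
  assert (Hc : forall t, I01 t -> u t = C (s t)).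
  { intros t I; apply Rminus_diag_uniq.
    transitivity (c t - C (s t)); [unfold c; rewrite Eu0, Ew0; ring|].
    apply (continuous01_zero (fun t => c t - C (s t)) t0); auto.
    - apply continuous01_of_derive; intros r Hr; eexists.
      apply is_derive01_c_minus; auto.
    - intros r Hr Hne; apply Hck; auto. }
  assert (Hk2 : forall t, I01 t -> k t * k t - K (s t) * K (s t) = 0).
  { apply (continuous01_zero _ t0).
    - apply continuous01_minus; apply continuous01_mult; auto.
    - intros r Hr Hne; apply Hck; auto. }
  assert (HKn : forall t, 0 < t < 1 -> K (s t) < 0).
  { intros t It; apply (hw_K_neg W), arclength_interior with l; auto. }
  assert (Hkn : forall t, 0 < t < 1 -> k t <> 0).
  { intros t It E0; assert (H := Hk2 t ltac:(unfold I01; lra)).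
    assert (H1 := HKn t It); rewrite E0 in H; nra. }
  assert (Hsign : exists e, (e = 1 \/ e = -1) /\
            forall t, 0 < t < 1 -> k t = e * K (s t)).
  { destruct (Rlt_dec (k (1 / 2)) 0) as [Hneg|Hpos].
    - exists 1; split; auto; intros t It.
      assert (H1 := sign_constant01 k Ck Hkn Hneg t It).
      assert (H2 := HKn t It); assert (H3 := Hk2 t ltac:(unfold I01; lra)); nra.
    - exists (-1); split; auto; intros t It.
      assert (Hk0 := Hkn (1 / 2) ltac:(lra)).
      assert (H1 : -1 * k t < 0).
      { apply (sign_constant01 (fun t => -1 * k t)); auto; try lra.
        - apply (continuous01_mult (fun _ => -1) k); auto.
          intros r; apply continuous_const.
        - intros r Hr; assert (H := Hkn r Hr); lra. }
      assert (H2 := HKn t It); assert (H3 := Hk2 t ltac:(unfold I01; lra)); nra. }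
  destruct Hsign as [e [He Hke]]; exists e; split; auto.
  assert (Hw : forall t, I01 t -> w t = e * S (s t)).
  { set (f := fun t => w t - e * S (s t)).
    assert (Df : forall t, I01 t -> is_derive01 f t
              (u t * (k t * v t) - e * (C (s t) * K (s t) * v t))).
    { intros t I; apply is_derive01_minus; auto.
      - apply (is_derive01_tangent l L); auto.
      - apply is_derive01_scal; auto; apply is_derive01_S_along; auto. }
    assert (Cf : continuous01 f).
    { apply continuous01_of_derive; intros t I; eexists; apply Df; auto. }
    assert (Df0 : forall t, 0 < t < 1 -> is_derive01 f t 0).
    { intros t It; assert (I : I01 t) by (unfold I01; lra).
      eapply is_derive01_value; [apply Df; auto|].
      rewrite (Hc t I), (Hke t It); ring. }
    assert (f0 : f t0 = 0).
    { unfold f; rewrite Ht0, hw_S_mid; fold w0; rewrite Ew0; ring. }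
    intros t I; apply Rminus_diag_uniq; fold (f t); rewrite <- f0.
    unfold I01 in I; destruct (Rle_dec t t0) as [Hle|Hle].
    - apply constant01; try lra; auto; intros r Hr; apply Df0; lra.
    - symmetry; apply constant01; try lra; auto; intros r Hr; apply Df0; lra. }
  assert (G0 : g 0 = (0, 0)) by apply Hg.
  intros t I; split; revert t I.
  - apply equal01_of_derive with (d := fun t => C (s t) * v t).
    + unfold cx, s; rewrite G0, arclength_0, (hw_X_0 W); reflexivity.
    + intros t I; rewrite <- Hc by auto; apply (is_derive01_cx l L); auto.
    + intros t I; apply is_derive01_along; auto; apply (hw_X W).
  - apply equal01_of_derive with (d := fun t => e * (S (s t) * v t)).
    + unfold cy, s; rewrite G0, arclength_0, (hw_Y_0 W); simpl; ring.
    + intros t I; rewrite <- Rmult_assoc, <- Hw by auto.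
      apply (is_derive01_cy l L); auto.
    + intros t I; apply is_derive01_scal; auto.
      apply is_derive01_along; auto; apply (hw_Y W).
Qed.

End Competitor.

Definition runs_along (e : R) (g : curve) : Prop :=
  forall t, I01 t -> cx g t = X (arclength g t) /\ cy g t = e * Y (arclength g t).

(** The midpoint in arc length of [g] serves as [t0]. *)
Lemma half_wave_minimal (g : curve) :
  admissible l L g ->
  wave_energy L <= elastic_energy g /\
  (elastic_energy g = wave_energy L <-> runs_along 1 g \/ runs_along (-1) g).
Proof.
  intros Hg.
  destruct (arclength_surj l L g (L / 2) Hg ltac:(lra)) as [t0 [It0 Ht0]].
  split; [apply (energy_lower_bound g Hg t0); auto|split].
  - intros E; destruct (energy_equality g Hg t0 It0 Ht0 E) as [e [[-> | ->] He]]; auto.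
  - intros [H|H]; eapply energy_of_half_wave; eauto; try (intros t Ht; apply H; auto);
      ring.
Qed.

End Minimality.

(** * Shape of the half wave *)

Section Shape.

Context (l L lam : R) (X Y C S K : R -> R).
Context (hl : 0 < l) (hL : 0 < L) (W : half_wave l L lam X Y C S K).

Lemma hw_Y_sym (s : R) : Y (L - s) = Y s.
Proof.
  revert s; apply equal_of_derive with (a := L / 2) (d := S).
  - f_equal; field.
  - intros s; apply is_derive_value with (d := -1 * S (L - s)).
    + apply (is_derive_comp Y (fun s => L - s)); [apply (hw_Y W)|].
      auto_derive; auto; ring.
    + rewrite (hw_S_sym W); ring.
  - apply (hw_Y W).
Qed.

Lemma hw_X_sym (s : R) : X (L - s) = l - X s.
Proof.
  revert s; apply equal_of_derive with (a := 0) (d := fun s => - C s).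
  - rewrite Rminus_0_r, (hw_X_L W), (hw_X_0 W); ring.
  - intros s; apply is_derive_value with (d := -1 * C (L - s)).
    + apply (is_derive_comp X (fun s => L - s)); [apply (hw_X W)|].
      auto_derive; auto; ring.
    + rewrite (hw_C_sym W); ring.
  - intros s; apply is_derive_value with (d := 0 - C s); [|ring].
    apply (is_derive_minus (fun _ => l) X); [apply (is_derive_const l)|].
    apply (hw_X W).
Qed.

Lemma hw_Y_increasing (s r : R) : 0 <= s -> s < r -> r <= L / 2 -> Y s < Y r.
Proof.
  intros Hs Hsr Hr; apply increasing_of_derive with (d := S); auto.
  - apply (hw_Y W).
  - intros x Hx; apply (hw_S_pos W); lra.
Qed.

Lemma hw_C_increasing (s r : R) : 0 <= s -> s < r -> r <= L / 2 -> C s < C r.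
Proof.
  intros Hs Hsr Hr.
  apply increasing_of_derive with (d := fun s => - (S s * K s)); auto.
  - apply (hw_C W).
  - intros x Hx.
    assert (H1 := hw_S_pos W x ltac:(lra)).
    assert (H2 := hw_K_neg W x ltac:(lra)); nra.
Qed.

(** On the left half [C] increases, so [X] decreases up to some point, possibly
    the start, and increases from there on; starting from [0], it cannot take its
    midpoint value [l / 2 > 0] earlier. *)
Lemma hw_X_mid_only (s : R) : 0 <= s < L / 2 -> X s <> l / 2.
Proof.
  intros Hs E.
  assert (Em : X (L / 2) = l / 2).
  { assert (H := hw_X_sym (L / 2)).
    replace (L - L / 2) with (L / 2) in H by field; lra. }
  assert (DX : forall r, derivable_pt_lim X r (C r)).
  { intros r; apply is_derive_Reals, (hw_X W). }
  destruct (MVT_cor2 X C s (L / 2) (proj2 Hs)) as [r [Er Hr]]; auto.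
  assert (Cr : C r = 0).
  { assert (C r * (L / 2 - s) = 0) by lra.
    destruct (Rmult_integral _ _ H); lra. }
  destruct (Req_dec s 0) as [->|Hne].
  { rewrite (hw_X_0 W) in E; lra. }
  destruct (MVT_cor2 X C 0 s ltac:(lra)) as [q [Eq Hq]]; auto.
  rewrite (hw_X_0 W), E in Eq.
  assert (H := hw_C_increasing q r ltac:(lra) ltac:(lra) ltac:(lra)); nra.
Qed.

(** Points of equal height are mirror images with respect to the midpoint, and
    mirror images with equal abscissae lie on the axis [x = l / 2], which the
    left half meets at the midpoint only. *)
Lemma half_wave_injective (s r : R) :
  0 <= s -> s < r -> r <= L -> X s = X r -> Y s = Y r -> False.
Proof.
  intros Hs Hsr Hr EX EY.
  destruct (Rle_dec r (L / 2)) as [H1|H1].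
  { assert (H := hw_Y_increasing s r Hs Hsr H1); lra. }
  assert (EYr := hw_Y_sym r).
  destruct (Rle_dec (L / 2) s) as [H2|H2].
  { assert (H := hw_Y_increasing (L - r) (L - s) ltac:(lra) ltac:(lra) ltac:(lra)).
    rewrite (hw_Y_sym s) in H; lra. }
  destruct (Rtotal_order s (L - r)) as [H|[H|H]].
  - assert (H3 := hw_Y_increasing s (L - r) ltac:(lra) H ltac:(lra)); lra.
  - apply (hw_X_mid_only s); [lra|].
    assert (E := hw_X_sym s); replace (L - s) with r in E by lra; lra.
  - assert (H3 := hw_Y_increasing (L - r) s ltac:(lra) H ltac:(lra)); lra.
Qed.

Lemma half_wave_no_loop (e : R) (g : curve) :
  e <> 0 -> admissible l L g -> runs_along X Y e g -> ~ has_loop g.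
Proof.
  intros He Hg Ha.
  assert (Hlt : forall t u, I01 t -> I01 u -> t < u -> g t <> g u).
  { intros t u Ht Hu Htu E.
    apply (half_wave_injective (arclength g t) (arclength g u)).
    - apply (arclength_range l L g t); auto.
    - apply (arclength_increasing l L); auto.
    - apply (arclength_range l L g u); auto.
    - destruct (Ha t Ht) as [<- _]; destruct (Ha u Hu) as [<- _].
      unfold cx; rewrite E; reflexivity.
    - apply Rmult_eq_reg_l with e; auto.
      destruct (Ha t Ht) as [_ <-]; destruct (Ha u Hu) as [_ <-].
      unfold cy; rewrite E; reflexivity. }
  intros (t & u & Ht & Hu & Hne & E).
  destruct (Rtotal_order t u) as [H|[H|H]]; [| contradiction |].
  - exact (Hlt t u Ht Hu H E).
  - exact (Hlt u t Hu Ht H (eq_sym E)).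
Qed.

Lemma half_wave_inflection (e : R) (g : curve) :
  e ^ 2 = 1 -> admissible l L g -> runs_along X Y e g ->
  forall t, I01 t -> (inflection_point g t <-> t = 0 \/ t = 1).
Proof.
  intros He Hg Ha t Ht.
  assert (Hk : forall t, I01 t -> curvature g t = e * K (arclength g t)).
  { apply (energy_of_half_wave l L lam X Y C S K W g Hg e He); intros r Hr;
      apply Ha; auto. }
  assert (HK : forall s, 0 <= s <= L -> K s <= 0).
  { intros s Hs; destruct (Req_dec s 0) as [->|H0].
    - rewrite (hw_K_0 W); lra.
    - destruct (Req_dec s L) as [->|HsL].
      + rewrite (hw_K_L l L lam X Y C S K W); lra.
      + left; apply (hw_K_neg W); lra. }
  split.
  - intros [[_ Hc]|[H _]]; auto; exfalso.
    destruct (Hc 1 ltac:(lra)) as (a & b & Ia & Ib & _ & _ & Hab).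
    rewrite (Hk a Ia), (Hk b Ib) in Hab.
    assert (H1 := HK _ (arclength_range l L g a Hg Ia)).
    assert (H2 := HK _ (arclength_range l L g b Hg Ib)).
    replace (e * K (arclength g a) * (e * K (arclength g b)))
      with (e ^ 2 * (K (arclength g a) * K (arclength g b))) in Hab by ring.
    rewrite He in Hab; nra.
  - intros H; right; split; auto; rewrite Hk by auto.
    destruct H as [-> | ->].
    + rewrite arclength_0, (hw_K_0 W); ring.
    + rewrite (arclength_1 l L g Hg), (hw_K_L l L lam X Y C S K W); ring.
Qed.

End Shape.

(** * Change of parameter *)

Lemma speed_lower_bound (l L : R) (g : curve) :
  admissible l L g -> exists m, 0 < m /\ forall t, I01 t -> m <= speed g t.
Proof.
  intros Hg.
  destruct (continuity_ab_min (fun t => speed g (clamp t)) 0 1) as [t [Hmin It]].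
  - lra.
  - intros t _; apply continuity_pt_filterlim.
    apply smooth01_continuous, (smooth01_speed l L); auto.
  - exists (speed g (clamp t)); split.
    + apply (speed_pos l L); auto; apply clamp_I01.
    + intros r Hr; rewrite <- (clamp_id r Hr); apply Hmin; exact Hr.
Qed.

(** The bound [m] makes [phi] Lipschitz near [t]; hence the errors in the linear
    approximations of [f] at [t] and of [g] at [phi t] are both small compared
    with [u - t], and these approximations agree as [g (phi u) = f u]. *)
Lemma is_derive01_lift (f f' g g' phi : R -> R) (m t : R) :
  0 < m -> I01 t ->
  (forall r, I01 r -> is_derive01 f r (f' r)) ->
  (forall r, I01 r -> is_derive01 g r (g' r)) ->
  (forall r, I01 r -> m <= g' r) ->
  (forall r, I01 r -> I01 (phi r) /\ g (phi r) = f r) ->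
  is_derive01 phi t (f' t / g' (phi t)).
Proof.
  intros Hm Ht Df Dg Hgm Hphi.
  assert (Exp : forall a b, I01 a -> I01 b -> m * Rabs (b - a) <= Rabs (g b - g a)).
  { assert (Lt : forall a b, I01 a -> I01 b -> a <= b -> m * (b - a) <= g b - g a).
    { intros a b Ha Hb [Hab|<-]; [|lra]; unfold I01 in *.
      destruct (continuous01_mvt g g' a b) as [c [Hc E]]; try lra.
      - apply continuous01_of_derive; intros r Hr; eexists; apply Dg; auto.
      - intros r Hr; apply Dg; unfold I01; lra.
      - rewrite E; apply Rmult_le_compat_r; [lra | apply Hgm; unfold I01; lra]. }
    intros a b Ha Hb; destruct (Rle_dec a b) as [H|H].
    - assert (H1 := Lt a b Ha Hb H).
      rewrite (Rabs_pos_eq (b - a)) by lra.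
      eapply Rle_trans; [exact H1 | apply Rle_abs].
    - assert (H1 := Lt b a Hb Ha ltac:(lra)).
      rewrite (Rabs_minus_sym b a), (Rabs_minus_sym (g b) (g a)).
      rewrite (Rabs_pos_eq (a - b)) by lra.
      eapply Rle_trans; [exact H1 | apply Rle_abs]. }
  destruct (Hphi t Ht) as [It Et].
  set (a := g' (phi t)); set (b := f' t).
  assert (Ha : 0 < a) by (assert (H := Hgm _ It); unfold a; lra).
  (* a local Lipschitz constant of phi *)
  set (M := (Rabs b + 1) / m).
  assert (HM : 0 < M).
  { apply Rdiv_lt_0_compat; auto; assert (H := Rabs_pos b); lra. }
  apply is_derive01_eps; intros eps Heps.
  set (e1 := eps * a / (M + 1)).
  assert (He1 : 0 < e1).
  { apply Rdiv_lt_0_compat; [apply Rmult_lt_0_compat; auto | lra]. }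
  destruct (proj1 (is_derive01_eps _ _ _) (Df t Ht) 1 Rlt_0_1) as [r0 [Hr0 H0]].
  destruct (proj1 (is_derive01_eps _ _ _) (Df t Ht) e1 He1) as [r1 [Hr1 H1]].
  destruct (proj1 (is_derive01_eps _ _ _) (Dg _ It) e1 He1) as [r2 [Hr2 H2]].
  exists (Rmin (Rmin r0 r1) (r2 / M)); split.
  { repeat apply Rmin_pos; auto; apply Rdiv_lt_0_compat; auto. }
  intros u Hu Hd.
  assert (Hd0 := Rlt_le_trans _ _ _ Hd (Rmin_l _ _)).
  assert (Hd1 := Rlt_le_trans _ _ _ Hd0 (Rmin_r _ _)).
  assert (Hd2 := Rlt_le_trans _ _ _ Hd (Rmin_r _ _)).
  apply (fun H => Rlt_le_trans _ _ _ H (Rmin_l _ _)) in Hd0.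
  destruct (Hphi u Hu) as [Iu Eu].
  specialize (H0 u Hu Hd0); specialize (H1 u Hu Hd1); fold b in H0, H1.
  assert (HL : Rabs (phi u - phi t) <= M * Rabs (u - t)).
  { assert (H := Exp _ _ It Iu); rewrite Eu, Et in H.
    assert (H3 := Rabs_triang (f u - f t - b * (u - t)) (b * (u - t))).
    replace (f u - f t - b * (u - t) + b * (u - t)) with (f u - f t) in H3 by ring.
    rewrite (Rabs_mult b) in H3.
    apply Rmult_le_reg_l with m; auto.
    replace (m * (M * Rabs (u - t))) with ((Rabs b + 1) * Rabs (u - t))
      by (unfold M; field; lra).
    lra. }
  assert (Hd3 : Rabs (phi u - phi t) < r2).
  { apply Rle_lt_trans with (1 := HL).
    apply Rmult_lt_reg_l with (/ M); [apply Rinv_0_lt_compat; auto|].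
    rewrite <- Rmult_assoc, Rinv_l by lra; unfold Rdiv in Hd2; lra. }
  specialize (H2 _ Iu Hd3); rewrite Eu, Et in H2; fold a in H2.
  replace (phi u - phi t - b / a * (u - t))
    with (/ a * ((f u - f t - b * (u - t))
                 - (f u - f t - a * (phi u - phi t)))) by (field; lra).
  assert (Hia := Rinv_0_lt_compat _ Ha).
  rewrite Rabs_mult, (Rabs_pos_eq (/ a)) by lra.
  apply Rmult_le_reg_l with a; auto.
  rewrite <- Rmult_assoc, Rinv_r, Rmult_1_l by lra.
  assert (H3 := Rabs_triang (f u - f t - b * (u - t))
                  (- (f u - f t - a * (phi u - phi t)))).
  rewrite Rabs_Ropp in H3.
  apply Rle_trans with (1 := H3).
  replace (a * (eps * Rabs (u - t))) with (e1 * ((M + 1) * Rabs (u - t)))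
    by (unfold e1; field; lra).
  assert (H4 : e1 * Rabs (phi u - phi t) <= e1 * (M * Rabs (u - t)))
    by (apply Rmult_le_compat_l; lra).
  lra.
Qed.

Definition transition (g h : curve) (t : R) : R :=
  iota (fun r : R => I01 r /\ arclength g r = arclength h t).

Lemma transition_spec (l L l' : R) (g h : curve) (t : R) :
  admissible l L g -> admissible l' L h -> I01 t ->
  I01 (transition g h t) /\ arclength g (transition g h t) = arclength h t.
Proof.
  intros Hg Hh Ht.
  destruct (arclength_surj l L g (arclength h t) Hg
              (arclength_range l' L h t Hh Ht)) as [r [Hr E]].
  apply (iota_correct (fun r : R => I01 r /\ arclength g r = arclength h t)).
  exists r; split; auto.
  intros r' [Hr' E']; apply (arclength_inj l L g); auto; lra.
Qed.

(** The change of parameter [phi] matches arc lengths, so that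
    [phi' = |h'| / (|g'| o phi)]; smoothness follows by bootstrapping. *)
Lemma equal_up_to_reparam_arclength (l L l' : R) (g h : curve) :
  admissible l L g -> admissible l' L h ->
  (forall t r, I01 t -> I01 r -> arclength g r = arclength h t -> h t = g r) ->
  equal_up_to_reparam g h.
Proof.
  intros Hg Hh E; set (phi := transition g h).
  assert (Hphi := fun t => transition_spec l L l' g h t Hg Hh); fold phi in Hphi.
  destruct (speed_lower_bound l L g Hg) as [m [Hm Hlow]].
  assert (Dphi : forall t, I01 t ->
            is_derive01 phi t (speed h t / speed g (phi t))).
  { intros t Ht.
    apply (is_derive01_lift (arclength h) (speed h) (arclength g) (speed g) phi m);
      auto.
    - intros r Hr; apply (is_derive01_arclength l' L); auto.
    - intros r Hr; apply (is_derive01_arclength l L); auto. }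
  exists phi; repeat split.
  - apply smooth01_differentiable; intros n; induction n as [|n IH]; [exact I|].
    exists (fun t => speed h t * / speed g (phi t)); split; [exact Dphi|].
    apply differentiable01_mult.
    + apply smooth01_differentiable, (smooth01_speed l' L); auto.
    + apply differentiable01_inv.
      * intros t Ht; apply Rgt_not_eq, (speed_pos l L); auto; apply Hphi; auto.
      * apply differentiable01_comp; auto; [intros t Ht; apply Hphi; auto|].
        apply smooth01_differentiable, (smooth01_speed l L); auto.
  - assert (I0 : I01 0) by (unfold I01; lra).
    destruct (Hphi 0 I0) as [I1 E0].
    apply (arclength_inj l L g); auto; rewrite E0, !arclength_0; reflexivity.
  - assert (I0 : I01 1) by (unfold I01; lra).
    destruct (Hphi 1 I0) as [I1 E0].
    apply (arclength_inj l L g); auto.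
    rewrite E0, (arclength_1 l L g Hg), (arclength_1 l' L h Hh); reflexivity.
  - intros t Ht; rewrite (Derive01_unique phi t _ Ht (Dphi t Ht)).
    apply Rdiv_lt_0_compat; [apply (speed_pos l' L) | apply (speed_pos l L)]; auto.
    apply Hphi; auto.
  - intros t Ht; apply E; auto; apply Hphi; auto.
Qed.

(** * The elliptic half wave *)

Section Hat.

Context (l L : R) (hl : 0 < l) (hL : l < L).

Let p := hat_p l L.
Let q := 2 * ellK p / L.

Lemma hat_p_range : 0 <= p < 1.
Proof. assert (H := hat_p_spec l L (conj hl hL)); fold p in H; lra. Qed.

Lemma hat_p_pos : 0 < p.
Proof. assert (H := hat_p_spec l L (conj hl hL)); fold p in H; lra. Qed.

Lemma hat_K_pos : 0 < ellK p.
Proof. apply ellK_pos, hat_p_range. Qed.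

Lemma hat_q_pos : 0 < q.
Proof. assert (H := hat_K_pos); apply Rdiv_lt_0_compat; lra. Qed.

(** The amplitude along the wave, running from [pi / 2] to [3 pi / 2]; the
    tangent angle is twice the angle of sine [p sin psi]. *)
Definition psi (s : R) : R := am (q * s + ellK p) p.

Definition hat_C (s : R) : R := 1 - 2 * p ^ 2 * sin (psi s) ^ 2.
Definition hat_S (s : R) : R := 2 * p * sin (psi s) * ellDelta p (psi s).
Definition hat_K (s : R) : R := 2 * q * p * cos (psi s).

Lemma is_derive_psi (s : R) : is_derive psi s (q * ellDelta p (psi s)).
Proof.
  apply (is_derive_comp (fun x => am x p) (fun s => q * s + ellK p)).
  - apply is_derive_am, hat_p_range.
  - auto_derive; auto; ring.
Qed.

Lemma is_derive_sin_psi (s : R) :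
  is_derive (fun s => sin (psi s)) s (q * ellDelta p (psi s) * cos (psi s)).
Proof.
  apply (is_derive_comp sin psi); [apply is_derive_sin | apply is_derive_psi].
Qed.

Lemma is_derive_cos_psi (s : R) :
  is_derive (fun s => cos (psi s)) s (q * ellDelta p (psi s) * - sin (psi s)).
Proof.
  apply (is_derive_comp cos psi); [apply is_derive_cos | apply is_derive_psi].
Qed.

Lemma is_derive_ellDelta_psi (s : R) :
  is_derive (fun s => ellDelta p (psi s)) s
    (q * (- p ^ 2 * sin (psi s) * cos (psi s))).
Proof.
  assert (H := ellDelta_pos p (psi s) hat_p_range).
  apply is_derive_value with (d := q * ellDelta p (psi s) *
    (- p ^ 2 * sin (psi s) * cos (psi s) / ellDelta p (psi s))); [|field; lra].
  apply (is_derive_comp (ellDelta p) psi); [|apply is_derive_psi].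
  apply is_derive_ellDelta, hat_p_range.
Qed.

Lemma psi_0 : psi 0 = PI / 2.
Proof.
  apply am_unique; [apply hat_p_range|].
  rewrite <- ellK_ellF by apply hat_p_range; fold p; ring.
Qed.

Lemma psi_mid : psi (L / 2) = PI.
Proof.
  apply am_unique; [apply hat_p_range|].
  rewrite <- (Rplus_0_l PI), ellF_quasiperiodic, ellF_0 by apply hat_p_range.
  rewrite <- ellK_ellF by apply hat_p_range; fold p; unfold q; field; lra.
Qed.

Lemma psi_sym (s : R) : psi (L - s) = 2 * PI - psi s.
Proof.
  apply am_unique; [apply hat_p_range|].
  replace (2 * PI - psi s) with (- psi s + PI + PI) by ring.
  rewrite !ellF_quasiperiodic, ellF_odd by apply hat_p_range.
  unfold psi; rewrite ellF_am by apply hat_p_range.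
  rewrite <- ellK_ellF by apply hat_p_range; fold p; unfold q; field; lra.
Qed.

Lemma psi_L : psi L = PI / 2 + PI.
Proof.
  replace L with (L - 0) at 1 by ring; rewrite psi_sym, psi_0; field.
Qed.

Lemma psi_increasing (s r : R) : s < r -> psi s < psi r.
Proof.
  intros H; apply am_increasing; [apply hat_p_range|].
  assert (Hq := hat_q_pos); nra.
Qed.

Lemma hat_C_derive (s : R) : is_derive hat_C s (- (hat_S s * hat_K s)).
Proof.
  apply is_derive_value with
    (d := 0 - 2 * p ^ 2 *
          (INR 2 * (q * ellDelta p (psi s) * cos (psi s)) * sin (psi s) ^ 1)).
  - apply (is_derive_minus (fun _ => 1) (fun s => 2 * p ^ 2 * sin (psi s) ^ 2));
      [apply (is_derive_const 1)|].
    apply (is_derive_scal (fun s => sin (psi s) ^ 2)).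
    apply (is_derive_pow (fun s => sin (psi s)) 2), is_derive_sin_psi.
  - unfold hat_S, hat_K; simpl INR; ring.
Qed.

Lemma hat_K_derive (s : R) : is_derive hat_K s (- (q ^ 2 * hat_S s)).
Proof.
  apply is_derive_value with
    (d := 2 * q * p * (q * ellDelta p (psi s) * - sin (psi s))).
  - apply (is_derive_scal (fun s => cos (psi s))), is_derive_cos_psi.
  - unfold hat_S; ring.
Qed.

Lemma hat_S_derive (s : R) : is_derive hat_S s (hat_C s * hat_K s).
Proof.
  apply is_derive_value with
    (d := 2 * p * (q * ellDelta p (psi s) * cos (psi s)) * ellDelta p (psi s)
          + 2 * p * sin (psi s) * (q * (- p ^ 2 * sin (psi s) * cos (psi s)))).
  - apply (Derive.is_derive_mult (fun s => 2 * p * sin (psi s))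
             (fun s => ellDelta p (psi s))).
    + apply (is_derive_scal (fun s => sin (psi s))), is_derive_sin_psi.
    + apply is_derive_ellDelta_psi.
  - replace (2 * p * (q * ellDelta p (psi s) * cos (psi s)) * ellDelta p (psi s))
      with (2 * p * q * cos (psi s) * ellDelta p (psi s) ^ 2) by ring.
    rewrite ellDelta_sqr by apply hat_p_range; unfold hat_C, hat_K; ring.
Qed.

Lemma hat_unit (s : R) : hat_C s ^ 2 + hat_S s ^ 2 = 1.
Proof.
  unfold hat_C, hat_S; rewrite Rpow_mult_distr.
  rewrite ellDelta_sqr by apply hat_p_range; ring.
Qed.

Lemma hat_X_derive (s : R) : is_derive (hat_X l L) s (hat_C s).
Proof.
  apply is_derive_value with
    (d := 2 * p ^ 2 * cos (psi s) ^ 2 + (1 - 2 * p ^ 2) * 1).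
  - apply (is_derive_plus
             (fun s => 2 * p ^ 2 * RInt (fun t => cos (psi t) ^ 2) 0 s)
             (fun s => (1 - 2 * p ^ 2) * s)).
    + apply (is_derive_scal (fun s => RInt (fun t => cos (psi t) ^ 2) 0 s)).
      apply (is_derive_primitive (fun t => cos (psi t) ^ 2)).
      intros r; apply (ex_derive_continuous (fun t => cos (psi t) ^ 2)).
      eexists; apply (is_derive_pow (fun t => cos (psi t)) 2), is_derive_cos_psi.
    + apply (is_derive_scal (fun s => s)), (is_derive_id s).
  - unfold hat_C; assert (H := sin2_cos2 (psi s)); unfold Rsqr in H.
    replace (sin (psi s) ^ 2) with (1 - cos (psi s) ^ 2) by lra; ring.
Qed.

Lemma hat_Y_derive (s : R) : is_derive (hat_Y l L) s (hat_S s).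
Proof.
  assert (HK := hat_K_pos).
  apply is_derive_value with
    (d := - (p * L / ellK p) * (q * ellDelta p (psi s) * - sin (psi s))).
  - apply (is_derive_scal (fun s => cos (psi s))), is_derive_cos_psi.
  - unfold hat_S, q; field; lra.
Qed.

(** As [C = 2 Delta(psi)^2 - 1] and [psi' = q Delta(psi)], the abscissa is an
    integral of [Delta] over the range of [psi]; its end value is the equation
    that defines the modulus. *)
Lemma hat_X_ellEinc (s : R) :
  hat_X l L s = 2 / q * (ellEinc (psi s) p - ellEinc (PI / 2) p) - s.
Proof.
  assert (Hq := hat_q_pos); revert s.
  apply equal_of_derive with (a := 0) (d := hat_C).
  - rewrite psi_0; unfold hat_X; rewrite RInt_point; unfold zero; simpl; ring.
  - apply hat_X_derive.
  - intros s; apply is_derive_value with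
      (d := 2 / q * (q * ellDelta p (psi s) * ellDelta p (psi s) - 0) - 1).
    + apply (is_derive_minus
        (fun s => 2 / q * (ellEinc (psi s) p - ellEinc (PI / 2) p)) (fun s => s));
        [|apply (is_derive_id s)].
      apply (is_derive_scal (fun s => ellEinc (psi s) p - ellEinc (PI / 2) p)).
      apply (is_derive_minus (fun s => ellEinc (psi s) p)
               (fun _ => ellEinc (PI / 2) p));
        [|apply (is_derive_const (ellEinc (PI / 2) p))].
      apply (is_derive_comp (fun x => ellEinc x p) psi); [|apply is_derive_psi].
      apply is_derive_ellEinc, hat_p_range.
    + replace (2 / q * (q * ellDelta p (psi s) * ellDelta p (psi s) - 0) - 1)
        with (2 * ellDelta p (psi s) ^ 2 - 1) by (field; lra).
      rewrite ellDelta_sqr by apply hat_p_range; unfold hat_C; ring.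
Qed.

Lemma hat_X_L : hat_X l L L = l.
Proof.
  rewrite hat_X_ellEinc, psi_L, ellEinc_quasiperiodic by apply hat_p_range.
  destruct (hat_p_spec l L (conj hl hL)) as [_ H]; fold p in H.
  assert (HK := hat_K_pos).
  rewrite <- ellE_ellEinc by apply hat_p_range.
  transitivity (L * (2 * ellE p / ellK p - 1)).
  - unfold q; field; lra.
  - rewrite H; field; lra.
Qed.

Lemma hat_half_wave :
  half_wave l L (q ^ 2) (hat_X l L) (hat_Y l L) hat_C hat_S hat_K.
Proof.
  assert (Hq := hat_q_pos); assert (Hp := hat_p_pos); assert (HPI := PI_RGT_0).
  split.
  - apply pow_lt; auto.
  - apply hat_X_derive.
  - apply hat_Y_derive.
  - apply hat_C_derive.
  - apply hat_S_derive.
  - apply hat_K_derive.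
  - apply hat_unit.
  - unfold hat_X; rewrite RInt_point; unfold zero; simpl; ring.
  - change (- (p * L / ellK p) * cos (psi 0) = 0).
    rewrite psi_0, cos_PI2; ring.
  - apply hat_X_L.
  - unfold hat_C; rewrite psi_mid, sin_PI; ring.
  - unfold hat_K; rewrite psi_0, cos_PI2; ring.
  - intros s Hs; unfold hat_K.
    assert (H1 := psi_increasing 0 s (proj1 Hs)).
    assert (H2 := psi_increasing s L (proj2 Hs)).
    rewrite psi_0 in H1; rewrite psi_L in H2.
    assert (Hc : cos (psi s) < 0) by (apply cos_lt_0; lra).
    assert (H0 : 0 < 2 * q * p).
    { apply Rmult_lt_0_compat; auto; apply Rmult_lt_0_compat; lra. }
    nra.
  - intros s Hs; unfold hat_S.
    assert (H2 := psi_increasing s (L / 2) (proj2 Hs)); rewrite psi_mid in H2.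
    assert (H1 : PI / 2 <= psi s).
    { rewrite <- psi_0; destruct Hs as [[H|<-] _]; [left|right]; auto.
      apply psi_increasing; auto. }
    assert (0 < sin (psi s)) by (apply sin_gt_0; lra).
    assert (0 < ellDelta p (psi s)) by (apply ellDelta_pos, hat_p_range).
    apply Rmult_lt_0_compat; auto; apply Rmult_lt_0_compat; auto; lra.
  - intros s; unfold hat_C; rewrite psi_sym.
    replace (2 * PI - psi s) with (- psi s + PI + PI) by ring.
    rewrite !neg_sin, sin_neg; ring.
  - intros s; unfold hat_S; rewrite psi_sym.
    replace (2 * PI - psi s) with (- psi s + PI + PI) by ring.
    rewrite !ellDelta_period, ellDelta_even, !neg_sin, sin_neg; ring.
  - intros s; unfold hat_K; rewrite psi_sym.
    replace (2 * PI - psi s) with (- psi s + PI + PI) by ring.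
    rewrite !neg_cos, cos_neg; ring.
Qed.

End Hat.

(** * The minimizers *)

Section Minimizers.

Context (l L : R) (hl : 0 < l) (hL : l < L).

(** The three Jacobi functions along the wave have derivatives polynomial in
    each other, so they are smooth together. *)
Lemma differentiable01_jacobi (n : nat) :
  differentiable01 n (fun t => sin (psi l L (L * t))) /\
  differentiable01 n (fun t => cos (psi l L (L * t))) /\
  differentiable01 n (fun t => ellDelta (hat_p l L) (psi l L (L * t))).
Proof.
  set (p := hat_p l L); set (q := 2 * ellK p / L).
  induction n as [|n (IS & IC & ID)]; [repeat split|].
  split; [|split].
  - exists (fun t => L * (q * (ellDelta p (psi l L (L * t)) * cos (psi l L (L * t)))));
      split.
    + intros t Ht; apply (is_derive01_dilate (fun s => sin (psi l L s))); auto.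
      rewrite <- Rmult_assoc; apply is_derive_sin_psi; auto.
    + do 2 apply differentiable01_scal; apply differentiable01_mult; auto.
  - exists (fun t => L * (q * -1 *
              (ellDelta p (psi l L (L * t)) * sin (psi l L (L * t))))); split.
    + intros t Ht; apply (is_derive01_dilate (fun s => cos (psi l L s))); auto.
      eapply is_derive_value; [apply is_derive_cos_psi; auto|].
      fold p q; ring.
    + do 2 apply differentiable01_scal; apply differentiable01_mult; auto.
  - exists (fun t => L * (q * - p ^ 2 *
              (sin (psi l L (L * t)) * cos (psi l L (L * t))))); split.
    + intros t Ht; apply (is_derive01_dilate (fun s => ellDelta p (psi l L s))); auto.
      eapply is_derive_value; [apply is_derive_ellDelta_psi; auto|].
      fold p q; ring.
    + do 2 apply differentiable01_scal; apply differentiable01_mult; auto.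
Qed.

Definition hat_curve (e : R) : curve :=
  fun t => (hat_X l L (L * t), e * hat_Y l L (L * t)).

Lemma is_derive01_hat_cx (e t : R) :
  I01 t -> is_derive01 (cx (hat_curve e)) t (L * hat_C l L (L * t)).
Proof.
  intros Ht; apply (is_derive01_dilate (hat_X l L)); auto.
  apply hat_X_derive; auto.
Qed.

Lemma is_derive01_hat_cy (e t : R) :
  I01 t -> is_derive01 (cy (hat_curve e)) t (e * (L * hat_S l L (L * t))).
Proof.
  intros Ht; apply (is_derive01_scal e (fun t => hat_Y l L (L * t))); auto.
  apply (is_derive01_dilate (hat_Y l L)); auto; apply hat_Y_derive; auto.
Qed.

Lemma smooth01_hat_curve (e : R) :
  smooth01 (cx (hat_curve e)) /\ smooth01 (cy (hat_curve e)).
Proof.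
  split.
  - apply smooth01_of_derive with (d := fun t => L * hat_C l L (L * t)).
    + apply is_derive01_hat_cx.
    + apply smooth01_differentiable; intros n; apply differentiable01_scal.
      destruct (differentiable01_jacobi n) as [HS _].
      apply differentiable01_ext with (f := fun t => 1 +
        -2 * hat_p l L ^ 2 * (sin (psi l L (L * t)) * sin (psi l L (L * t)))).
      * intros t _; unfold hat_C; ring.
      * apply differentiable01_plus; [apply differentiable01_const|].
        apply differentiable01_scal, differentiable01_mult; auto.
  - apply smooth01_differentiable; intros n; do 2 apply differentiable01_scal.
    apply differentiable01_jacobi.
Qed.

Lemma speed_hat_curve (e t : R) : e ^ 2 = 1 -> I01 t -> speed (hat_curve e) t = L.
Proof.
  intros He Ht; unfold speed, velocity; simpl fst; simpl snd.
  rewrite (Derive01_unique _ t _ Ht (is_derive01_hat_cx e t Ht)).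
  rewrite (Derive01_unique _ t _ Ht (is_derive01_hat_cy e t Ht)).
  replace (_ + _) with (L ^ 2 * (hat_C l L (L * t) ^ 2
                                 + e ^ 2 * hat_S l L (L * t) ^ 2)) by ring.
  rewrite He, Rmult_1_l, (hat_unit l L hl hL), Rmult_1_r.
  apply sqrt_pow2; lra.
Qed.

Lemma arclength_hat_curve (e t : R) :
  e ^ 2 = 1 -> I01 t -> arclength (hat_curve e) t = L * t.
Proof.
  intros He Ht; unfold arclength; rewrite RInt_ext with (g := fun _ => L).
  - rewrite RInt_const; unfold scal; simpl; unfold mult; simpl; ring.
  - unfold I01 in Ht; rewrite Rmin_left, Rmax_right by lra.
    intros r Hr; apply speed_hat_curve; auto; unfold I01; lra.
Qed.

Lemma hat_Y_ends : hat_Y l L 0 = 0 /\ hat_Y l L L = 0.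
Proof.
  assert (W := hat_half_wave l L hl hL).
  assert (H0 := hw_Y_0 W); split; auto.
  rewrite <- H0, <- (hw_Y_sym _ _ _ _ _ _ _ _ W 0); f_equal; ring.
Qed.

Lemma hat_curve_admissible (e : R) : e ^ 2 = 1 -> admissible l L (hat_curve e).
Proof.
  intros He; destruct (smooth01_hat_curve e) as [Sx Sy].
  destruct hat_Y_ends as [Y0 YL]; repeat split; auto.
  - unfold hat_curve; rewrite Rmult_0_r, Y0, Rmult_0_r.
    rewrite (hw_X_0 (hat_half_wave l L hl hL)); reflexivity.
  - unfold hat_curve; rewrite Rmult_1_r, YL, Rmult_0_r, hat_X_L; auto.
  - intros t Ht E; assert (H := speed_hat_curve e t He Ht).
    unfold speed in H; rewrite E in H; simpl fst in H; simpl snd in H.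
    replace (0 ^ 2 + 0 ^ 2) with 0 in H by ring; rewrite sqrt_0 in H; lra.
  - unfold curve_length; rewrite arclength_hat_curve; auto; [ring|].
    unfold I01; lra.
Qed.

Lemma hat_curve_runs_along (e : R) :
  e ^ 2 = 1 -> runs_along (hat_X l L) (hat_Y l L) e (hat_curve e).
Proof.
  intros He t Ht; rewrite arclength_hat_curve by auto; split; reflexivity.
Qed.

(** The lower bound is attained by [hat_curve], so minimality means equality in
    it. *)
Lemma global_minimizer_iff_runs_along (g : curve) :
  admissible l L g ->
  (global_minimizer l L g <->
   runs_along (hat_X l L) (hat_Y l L) 1 g \/ runs_along (hat_X l L) (hat_Y l L) (-1) g).
Proof.
  intros Hg.
  assert (M := half_wave_minimal l L _ _ _ _ _ _ hl (Rlt_trans _ _ _ hl hL)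
                 (hat_half_wave l L hl hL)).
  split.
  - intros [_ Hmin]; apply (M g Hg).
    assert (He : 1 ^ 2 = 1) by ring.
    assert (H1 := hat_curve_admissible 1 He).
    apply Rle_antisym; [|apply (M g Hg)].
    replace (wave_energy (hat_K l L) L) with (elastic_energy (hat_curve 1)); auto.
    apply (M _ H1); left; apply hat_curve_runs_along; auto.
  - intros Ha; split; auto; intros h Hh.
    apply (M g Hg) in Ha; rewrite Ha; apply (M h Hh).
Qed.

Lemma equal_on_hat_iff (g : curve) :
  admissible l L g ->
  (equal_on L (arclength_reparam g) (hat_gamma_plus l L) <->
   runs_along (hat_X l L) (hat_Y l L) 1 g) /\
  (equal_on L (arclength_reparam g) (hat_gamma_minus l L) <->
   runs_along (hat_X l L) (hat_Y l L) (-1) g).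
Proof.
  intros Hg; rewrite !(equal_on_arclength l L g _ Hg).
  unfold hat_gamma_plus, hat_gamma_minus, runs_along, cx, cy.
  split; split; intros H t Ht; specialize (H t Ht).
  - rewrite H; simpl; split; ring.
  - rewrite (surjective_pairing (g t)); destruct H as [-> ->]; f_equal; ring.
  - rewrite H; simpl; split; ring.
  - rewrite (surjective_pairing (g t)); destruct H as [-> ->]; f_equal; ring.
Qed.

Lemma runs_along_reflect (X Y : R -> R) (e : R) (g : curve) :
  admissible l L g -> runs_along X Y e g ->
  admissible l L (reflect_x g) /\ runs_along X Y (- e) (reflect_x g).
Proof.
  intros Hg Ha.
  assert (Dy : forall t, I01 t ->
            Derive01 (cy (reflect_x g)) t = - Derive01 (cy g) t).
  { intros t Ht; apply Derive01_unique; auto.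
    apply is_derive01_opp; auto; apply smooth01_is_derive01; auto; apply Hg. }
  assert (Sp : forall t, I01 t -> speed (reflect_x g) t = speed g t).
  { intros t Ht; unfold speed, velocity; simpl fst; simpl snd.
    rewrite (Dy t Ht); f_equal.
    change (cx (reflect_x g)) with (cx g); ring. }
  assert (Al : forall t, I01 t -> arclength (reflect_x g) t = arclength g t).
  { intros t Ht; apply RInt_ext; unfold I01 in Ht.
    rewrite Rmin_left, Rmax_right by lra.
    intros r Hr; apply Sp; unfold I01; lra. }
  split.
  - assert (Hpos := fun t => speed_pos l L g t Hg).
    destruct Hg as (Sx & Sy & G0 & G1 & _ & GL); repeat split; auto.
    + apply smooth01_opp; auto.
    + unfold reflect_x, cx, cy; rewrite G0; simpl; f_equal; ring.
    + unfold reflect_x, cx, cy; rewrite G1; simpl; f_equal; ring.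
    + intros t Ht E; assert (H := Hpos t Ht); rewrite <- Sp in H by auto.
      unfold speed in H; rewrite E in H; simpl fst in H; simpl snd in H.
      replace (0 ^ 2 + 0 ^ 2) with 0 in H by ring; rewrite sqrt_0 in H; lra.
    + unfold curve_length; rewrite Al; auto; unfold I01; lra.
  - intros t Ht; rewrite Al by auto; destruct (Ha t Ht) as [E1 E2]; split.
    + exact E1.
    + change (cy (reflect_x g) t) with (- cy g t); rewrite E2; ring.
Qed.

Lemma runs_along_equal_up_to_reparam (X Y : R -> R) (e : R) (g h : curve) :
  admissible l L g -> admissible l L h ->
  runs_along X Y e g -> runs_along X Y e h -> equal_up_to_reparam g h.
Proof.
  intros Hg Hh Ag Ah; apply (equal_up_to_reparam_arclength l L l); auto.
  intros t r Ht Hr E; rewrite (surjective_pairing (h t)), (surjective_pairing (g r)).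
  destruct (Ag r Hr) as [X1 Y1]; destruct (Ah t Ht) as [X2 Y2].
  rewrite E in X1, Y1; unfold cx, cy in *; f_equal; congruence.
Qed.

End Minimizers.

Theorem theorem1p3 (l L : R) (hl : 0 < l) (hL : l < L) :
  (* the global minimizers are exactly the two curves, up to parametrization *)
  (forall g : curve, admissible l L g ->
     (global_minimizer l L g <->
        equal_on L (arclength_reparam g) (hat_gamma_plus l L) \/
        equal_on L (arclength_reparam g) (hat_gamma_minus l L)))
  (* both are attained, by their constant speed parametrizations over [0,1] *)
  /\ global_minimizer l L (fun t => hat_gamma_plus l L (L * t))
  /\ global_minimizer l L (fun t => hat_gamma_minus l L (L * t))
  (* (i) *)
  /\ (forall g h : curve, global_minimizer l L g -> global_minimizer l L h ->
        equal_up_to_reparam g h \/ equal_up_to_reparam (reflect_x g) h)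
  (* (ii) *)
  /\ (forall g : curve, global_minimizer l L g ->
        ~ has_loop g /\
        (forall t : R, I01 t -> (inflection_point g t <-> t = 0 \/ t = 1))).
Proof.
  assert (Hchar : forall g, global_minimizer l L g -> admissible l L g /\
    (runs_along (hat_X l L) (hat_Y l L) 1 g \/
     runs_along (hat_X l L) (hat_Y l L) (-1) g)).
  { intros g Hg; split; [apply Hg|].
    apply (global_minimizer_iff_runs_along l L hl hL); auto; apply Hg. }
  assert (Hhat : forall e, e ^ 2 = 1 -> (e = 1 \/ e = -1) ->
            global_minimizer l L (hat_curve l L e)).
  { intros e He Hpm; assert (Ha := hat_curve_admissible l L hl hL e He).
    assert (Hr := hat_curve_runs_along l L hl hL e He).
    apply (global_minimizer_iff_runs_along l L hl hL); auto.
    destruct Hpm as [-> | ->]; auto. }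
  assert (W := hat_half_wave l L hl hL).
  assert (HL : 0 < L) by lra.
  split; [|split; [|split; [|split]]].
  - intros g Hg; destruct (equal_on_hat_iff l L g Hg) as [-> ->].
    apply global_minimizer_iff_runs_along; auto.
  - replace (fun t => hat_gamma_plus l L (L * t)) with (hat_curve l L 1);
      [apply Hhat; auto; ring|].
    apply functional_extensionality; intros t.
    unfold hat_curve, hat_gamma_plus; f_equal; ring.
  - replace (fun t => hat_gamma_minus l L (L * t)) with (hat_curve l L (-1));
      [apply Hhat; auto; ring|].
    apply functional_extensionality; intros t.
    unfold hat_curve, hat_gamma_minus; f_equal; ring.
  - intros g h Hg Hh.
    destruct (Hchar g Hg) as [Ag Rg]; destruct (Hchar h Hh) as [Ah Rh].
    assert (Hsame : forall e, runs_along (hat_X l L) (hat_Y l L) e g ->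
              runs_along (hat_X l L) (hat_Y l L) e h -> equal_up_to_reparam g h).
    { intros e; apply (runs_along_equal_up_to_reparam l L (hat_X l L) (hat_Y l L)); auto. }
    assert (Hopp : forall e, runs_along (hat_X l L) (hat_Y l L) e g ->
              runs_along (hat_X l L) (hat_Y l L) (- e) h ->
              equal_up_to_reparam (reflect_x g) h).
    { intros e He He'.
      destruct (runs_along_reflect l L _ _ e g Ag He) as [Ar Rr].
      apply (runs_along_equal_up_to_reparam l L (hat_X l L) (hat_Y l L) (- e)); auto. }
    destruct Rg as [Rg|Rg]; destruct Rh as [Rh|Rh].
    + left; exact (Hsame 1 Rg Rh).
    + right; apply (Hopp 1 Rg).
      replace (- (1)) with (-1) by ring; exact Rh.
    + right; apply (Hopp (-1) Rg).
      replace (- -1) with 1 by ring; exact Rh.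
    + left; exact (Hsame (-1) Rg Rh).
  - intros g Hg; destruct (Hchar g Hg) as [Ag Rg].
    assert (He : exists e, e ^ 2 = 1 /\ e <> 0 /\
                   runs_along (hat_X l L) (hat_Y l L) e g).
    { destruct Rg; [exists 1 | exists (-1)];
        (split; [ring | split; [lra | auto]]). }
    destruct He as (e & He2 & He0 & Re); split.
    + exact (half_wave_no_loop l L _ _ _ _ _ _ hl W e g He0 Ag Re).
    + exact (half_wave_inflection l L _ _ _ _ _ _ W e g He2 Ag Re).
Qed.
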